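(* Let $r \geq 1$, let $\{(G_i,\theta_i)\}_{i\in[r]}$ be an admissible sequence of $2$-groups and let $G := G_r$. Then the map $$P_G : \mathrm{Prim}(\mathcal{S}^{G - \{\mathrm{id}\}}) \to \mathrm{Epi}_{\mathrm{top.gr.}}(\mathcal{G}_{\mathbb{Q}}^{\mathrm{pro}-2}, G) \cup \{\bullet\}$$ is a surjection, which restricts to a bijection between $\mathrm{Prim}(\mathcal{S}^{G-\{\mathrm{id}\}})(\mathrm{solv.})$ and the set of surjective continuous homomorphisms $\mathrm{Epi}_{\mathrm{top.gr.}}(\mathcal{G}_{\mathbb{Q}}^{\mathrm{pro}-2}, G)$.
   Context: **Galois groups and generators.** Fix a separable closure $\mathbb{Q}^{\mathrm{sep}}$, $G_{\mathbb{Q}} = \mathrm{Gal}(\mathbb{Q}^{\mathrm{sep}}/\mathbb{Q})$, and for each prime $p$ a separable closure $\mathbb{Q}_p^{\mathrm{sep}}$ with an embedding $\mathbb{Q}^{\mathrm{sep}} \to \mathbb{Q}_p^{\mathrm{sep}}$, inducing $i_p^* : G_{\mathbb{Q}_p} \to G_{\mathbb{Q}}$. Let $I_p \subseteq G_{\mathbb{Q}_p}$ be the inertia subgroup, $\mathcal{P}$ the set of odd primes, $\mathbb{Q}^{\mathrm{pro}-2}$ the compositum of all finite Galois extensions of $\mathbb{Q}$ of $2$-power degree, $\mathcal{G}_{\mathbb{Q}}^{\mathrm{pro}-2} = \mathrm{Gal}(\mathbb{Q}^{\mathrm{pro}-2}/\mathbb{Q})$, and $I_p(2)$ the image of $i_p^*(I_p)$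 in $\mathcal{G}_{\mathbb{Q}}^{\mathrm{pro}-2}$. For $a \in \mathbb{Q}^*$ let $\chi_a : G_{\mathbb{Q}} \to \mathbb{F}_2$ be the quadratic character of $\mathbb{Q}(\sqrt{a})$. For $p \in \mathcal{P}$ the group $I_p(2)$ is pro-cyclic; fix a topological generator $\sigma_p$. Fix $\sigma_2(1), \sigma_2(2) \in I_2(2)$ with $\chi_2(\sigma_2(1)) = 1$, $\chi_2(\sigma_2(2)) = 0$, $\chi_{-1}(\sigma_2(1)) = 0$, $\chi_{-1}(\sigma_2(2)) = 1$. The set $\Sigma := \{\sigma_p\}_{p\in\mathcal{P}} \cup \{\sigma_2(1), \sigma_2(2)\}$ topologically generates $\mathcal{G}_{\mathbb{Q}}^{\mathrm{pro}-2}$. **Squarefree tuples.** $[r] = \{1,\dots,r\}$. $\mathcal{S}$ is the set of squarefree integers (possibly negative). For a finite set $I$, $\mathrm{Prim}(\mathcal{S}^{I})$ is the set of tuples in $\mathcal{S}^{I}$ whose entries are pairwise coprime, where coprimality of two integers also requires that they are not both negative. **Admissible sequences.** A sequence $\{(G_i,\theta_i)\}_{i \in [r]}$ is admissible if, with $G_0$ the trivial group, for each $i\in[r]$: $\theta_i : G_{i-1}^2 \to \mathbb{F}_2$ is a $2$-cocycle (trivial action) with $\theta_i(\mathrm{id},\mathrm{id}) = 0$; $\theta_i$ is trivial in $H^2(G_{i-1},\mathbb{F}_2)$ if and only if $\theta_i$ is the zero map; and $G_i = (\mathbb{F}_2 \times G_{i-1}, *_{\theta_i})$ with group law $(a_1,g_1)*_{\theta_i}(a_2,g_2)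 = (a_1+a_2+\theta_i(g_1,g_2), g_1g_2)$. As a set $G = G_r$ is $\mathbb{F}_2^{[r]}$, with identity $(0,\dots,0)$; the $j$-th coordinate $\pi_j(g)$ of $g \in G$ is the $\mathbb{F}_2$-entry adjoined at step $j$. **The map $P_G$.** $\mathrm{Epi}_{\mathrm{top.gr.}}$ denotes surjective continuous homomorphisms, and $\bullet$ is a formal extra symbol. Given $v = (v_1,\dots,v_r) \in \mathcal{S}^r$ define $\tilde{P}_G(v)$ recursively, starting with $\psi_0$ the trivial map to $G_0$. For $i = 0,\dots,r-1$, suppose $\psi_i \in \mathrm{Epi}_{\mathrm{top.gr.}}(\mathcal{G}_{\mathbb{Q}}^{\mathrm{pro}-2}, G_i)$ has been obtained. (1) If the class of $\psi_i^*(\theta_{i+1})$ in $H^2(G_{\mathbb{Q}},\mathbb{F}_2)$ is non-trivial, put $\tilde{P}_G(v) = \bullet$. (2) Otherwise, if $\theta_{i+1} = 0$: if $\chi_{v_{i+1}}$ lies in the $\mathbb{F}_2$-span of $\{\chi_{v_j} : j \leq i,\ \theta_j = 0\}$ (for $i=0$: if $\chi_{v_1}$ is trivial), put $\tilde{P}_G(v)=\bullet$; else put $\psi_{i+1} = (\chi_{v_{i+1}},\psi_i)$. (3) Otherwise, if $\theta_{i+1} \neq 0$: let $\phi: G_{\mathbb{Q}} \to \mathbb{F}_2$ be the unique continuous $1$-cochain with $\phi(\sigma\tau) - \phi(\sigma) - \phi(\tau) = \theta_{i+1}(\psi_i(\sigma),\psi_i(\tau))$ for all $\sigma,\tau$ (such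 a $\phi$ factors through $\mathcal{G}_{\mathbb{Q}}^{\mathrm{pro}-2}$) that vanishes on every element of $\Sigma$, and put $\psi_{i+1} = (\phi + \chi_{v_{i+1}}, \psi_i)$, an epimorphism onto $G_{i+1}$. If $\bullet$ never occurs, $\tilde{P}_G(v) := \psi_r$. Finally $P_G := \tilde{P}_G \circ \mathrm{Pow}([r])$, where $\mathrm{Pow}([r]) : \mathrm{Prim}(\mathcal{S}^{G-\{\mathrm{id}\}}) \to \mathcal{S}^r$ is the bijection $(v_g)_{g \neq \mathrm{id}} \mapsto \left(\prod_{g : \pi_j(g) = 1} v_g\right)_{j\in[r]}$, and $$\mathrm{Prim}(\mathcal{S}^{G-\{\mathrm{id}\}})(\mathrm{solv.}) := P_G^{-1}\left(\mathrm{Epi}_{\mathrm{top.gr.}}(\mathcal{G}_{\mathbb{Q}}^{\mathrm{pro}-2},G)\right).$$ *)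

(* Defs.v *)
From HB Require Import structures.
From mathcomp Require Import all_boot all_order all_algebra all_field.
From mathcomp Require Import all_classical all_reals topology.

Set Implicit Arguments.
Unset Strict Implicit.
Unset Printing Implicit Defensive.

Import GRing.Theory Num.Theory.
Local Open Scope classical_set_scope.
Local Open Scope ring_scope.

(* An automorphism of a field of characteristic 0 fixes Q, so that [aut L] is
   the Galois group of L over Q when L is a Galois extension of Q. *)
Record aut (L : fieldType) := Aut {
  aut_val :> {rmorphism L -> L};
  aut_bij : bijective aut_val }.

Section AutGroup.
Variable L : fieldType.
Implicit Types s t : aut L.

Lemma aut_eq s t : s =1 t -> s = t.
Proof.
case: s t => [s bs] [t bt] /= st.
suff E : s = t by destruct E; congr Aut; exact: Prop_irrelevance.
clear bs bt; destruct s as [s ms], t as [t mt]; simpl in st.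
have E : s = t by apply/funext => x; exact: st.
destruct E; congr GRing.RMorphism.Pack.
destruct ms as [a1 b1], mt as [a2 b2].
destruct a1 as [a1], a2 as [a2], b1 as [b1], b2 as [b2].
by rewrite (Prop_irrelevance a1 a2) (Prop_irrelevance b1 b2).
Qed.

Definition aut_one : aut L := @Aut L idfun (Bijective (frefl _) (frefl _)).

Definition aut_mul s t : aut L :=
  @Aut L (s \o t)%FUN (bij_comp (aut_bij s) (aut_bij t)).

Lemma aut_inv_ex s : exists u : aut L, cancel s u /\ cancel u s.
Proof.
have [g sK gK] := aut_bij s.
have gz : zmod_morphism g by exact: (can2_zmod_morphism sK gK).
have gm : monoid_morphism g by exact: (can2_monoid_morphism sK gK).
pose gA := GRing.isZmodMorphism.Build L L g gz.
pose gM := GRing.isMonoidMorphism.Build L L g gm.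
pose gR : {rmorphism L -> L} := HB.pack g gA gM.
by exists (@Aut L gR (Bijective gK sK)).
Qed.

Definition aut_inv s : aut L := projT1 (cid (aut_inv_ex s)).

Lemma aut_mulA : associative aut_mul.
Proof. by move=> s t u; apply: aut_eq. Qed.

Lemma aut_mul1 : left_id aut_one aut_mul.
Proof. by move=> s; apply: aut_eq. Qed.

Lemma aut_mulr1 : right_id aut_one aut_mul.
Proof. by move=> s; apply: aut_eq. Qed.

Lemma aut_mulV : left_inverse aut_one aut_inv aut_mul.
Proof.
move=> s; apply: aut_eq => x /=.
by rewrite /aut_inv; case: cid => u [/= sK _]; exact: sK.
Qed.

Lemma aut_mulrV : right_inverse aut_one aut_inv aut_mul.
Proof.
move=> s; apply: aut_eq => x /=.
by rewrite /aut_inv; case: cid => u [/= _ uK]; exact: uK.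
Qed.

HB.instance Definition _ := gen_eqMixin (aut L).
HB.instance Definition _ := gen_choiceMixin (aut L).
HB.instance Definition _ :=
  isGroup.Build (aut L) aut_mulA aut_mul1 aut_mulr1 aut_mulV aut_mulrV.

Definition aut_graph (s : aut L) :
  prod_topology (fun _ : L => discrete_topology L) := s.

(* The Krull topology is the topology of pointwise convergence, L being given
   the discrete topology. *)
HB.instance Definition _ :=
  Topological.copy (aut L) (initial_topology aut_graph).

End AutGroup.

Section Restriction.
Variables (L M : fieldType) (e : {rmorphism L -> M}).

Definition aut_stable := forall (s : aut M) (x : L), exists y, e y = s (e x).

Hypothesis eS : aut_stable.

Lemma restr_ex (s : aut M) :
  exists u : aut L, forall x, e (u x) = s (e x).
Proof.
have ex (t : aut M) : {f : L -> L | forall x, e (f x) = t (e x)}.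
  by exists (fun x => projT1 (cid (eS t x))) => x; case: cid.
have [f fE] := ex s.
have [t [sK tK]] := aut_inv_ex s.
have [g gE] := ex t.
have ei := fmorph_inj e.
have fz : zmod_morphism f by move=> x y; apply: ei; rewrite rmorphB !fE !rmorphB.
have fm : monoid_morphism f.
  by split=> [|x y]; apply: ei; rewrite ?rmorphM !fE ?rmorph1 ?rmorphM.
pose fA := GRing.isZmodMorphism.Build L L f fz.
pose fM := GRing.isMonoidMorphism.Build L L f fm.
pose fR : {rmorphism L -> L} := HB.pack f fA fM.
have fB : bijective fR.
  by exists g => x; apply: ei; rewrite ?fE ?gE ?fE ?sK ?tK.
by exists (@Aut L fR fB).
Qed.

Definition restr (s : aut M) : aut L := projT1 (cid (restr_ex s)).

Lemma restrE s x : e (restr s x) = s (e x).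
Proof. by rewrite /restr; case: cid. Qed.

End Restriction.

(* [algC] is the separable closure of Q; the compositum is the smallest
   subfield of it containing all the fields in question. *)
Definition pro2_pred : {pred algC} := fun x =>
  `[< forall S : {pred algC}, divring_closed S ->
      (forall (K : splittingFieldType rat) (f : {rmorphism K -> algC}) (n : nat),
        galois 1 {:K} -> \dim {:K} = (2 ^ n)%N -> forall y, f y \in S) ->
      x \in S >].

Lemma pro2_divring_closed : divring_closed pro2_pred.
Proof.
split=> [|x y /asboolP xP /asboolP yP|x y /asboolP xP /asboolP yP];
  apply/asboolP => S SC KS; have [S1 SB SV] := SC => //.
- by apply: SB; [exact: xP | exact: yP].
- by apply: SV; [exact: xP | exact: yP].
Qed.

HB.instance Definition _ :=
  GRing.isDivringClosed.Build algC pro2_pred pro2_divring_closed.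

Record Qpro2 := MkQpro2 { Qpro2_val : algC; _ : Qpro2_val \in pro2_pred }.

HB.instance Definition _ := [isSub for Qpro2_val].
HB.instance Definition _ := [Choice of Qpro2 by <:].
HB.instance Definition _ := [SubChoice_isSubIntegralDomain of Qpro2 by <:].
HB.instance Definition _ := [SubIntegralDomain_isSubField of Qpro2 by <:].
Definition Qpro2_incl : {rmorphism Qpro2 -> algC} := val.

Lemma pro2_stable : aut_stable Qpro2_incl.
Proof.
move=> s x.
suff sx : s (val x) \in pro2_pred by exists (MkQpro2 sx).
have /asboolP xP := valP x.
apply/asboolP => S SC KS; have [S1 SB SV] := SC.
apply: (xP [pred y | s y \in S]) => [|K f n gK dK y].
  split=> [|y z|y z]; rewrite !inE ?rmorph1 ?rmorphB ?fmorph_div //.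
    exact: SB.
  exact: SV.
exact: (KS K (s \o f)%FUN n).
Qed.

Notation GQ := (aut algC).
Notation GQpro2 := (aut Qpro2).

Definition res_pro2 : GQ -> GQpro2 := restr pro2_stable.

Definition padic_norm (p : nat) (x : rat) : rat :=
  if x == 0 then 0
  else p%:R ^+ logn p `|denq x| / p%:R ^+ logn p `|numq x|.

Definition is_cauchy (K : fieldType) (N : K -> rat) (u : nat -> K) : Prop :=
  forall eps : rat, 0 < eps -> exists k, forall m n,
    (k <= m)%N -> (k <= n)%N -> N (u m - u n) < eps.

Definition converges_to (K : fieldType) (N : K -> rat) (u : nat -> K) (l : K) :=
  forall eps : rat, 0 < eps -> exists k, forall n, (k <= n)%N -> N (u n - l) < eps.

(* (K, N) is the completion of (Q, |.|_p). The absolute value of Q_p only takes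
   the values of |.|_p on Q, so it can be taken with values in [rat]. *)
Record padic_completion (p : nat) (K : fieldType) (N : K -> rat) : Prop := {
  padic_eq0 : forall x, N x = 0 -> x = 0;
  padicM : forall x y, N (x * y) = N x * N y;
  padicD : forall x y, N (x + y) <= Num.max (N x) (N y);
  padic_ratr : forall q : rat, N (ratr q) = padic_norm p q;
  padic_dense : forall x (eps : rat), 0 < eps -> exists q, N (x - ratr q) < eps;
  padic_complete : forall u, is_cauchy N u -> exists l, converges_to N u l }.

Definition separable_over (K L : fieldType) (i : {rmorphism K -> L}) (x : L) :=
  exists2 P : {poly K}, separable_poly P & root (map_poly i P) x.

Definition separably_closed (L : fieldType) :=
  forall P : {poly L}, separable_poly P -> (1 < size P)%N -> exists x, root P x.

(* Q_p, a separable closure of it, and an embedding of the separable closure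
   of Q into it. *)
Record local_closure (p : nat) := {
  Qp : fieldType;
  Qp_abs : Qp -> rat;
  Qp_completion : padic_completion p Qp_abs;
  Qpsep : fieldType;
  Qp_incl : {rmorphism Qp -> Qpsep};
  Qpsep_separable : forall x, separable_over Qp_incl x;
  Qpsep_closed : separably_closed Qpsep;
  Qsep_emb : {rmorphism algC -> Qpsep} }.

Lemma Qsep_stable (M : fieldType) (e : {rmorphism algC -> M}) : aut_stable e.
Proof.
move=> s x.
have [P [PE _] _] := minCpolyP x.
have [r rE] := closed_field_poly_normal (minCpoly x).
pose se : {rmorphism algC -> M} := (s \o e)%FUN.
have : root (map_poly e (minCpoly x)) (se x).
  have -> : map_poly e (minCpoly x) = map_poly se (minCpoly x).
    by rewrite PE -!map_poly_comp !(eq_map_poly (fmorph_rat _)).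
  by rewrite fmorph_root root_minCpoly.
rewrite rE (monicP (minCpoly_monic x)) scale1r rmorph_prod rootE horner_prod.
rewrite prodf_seq_eq0 => /hasP[z _ /=].
by rewrite rmorphB /= map_polyX map_polyC /= !hornerE subr_eq0 => /eqP ->; exists z.
Qed.

Section Inertia.
Variables (p : nat) (D : local_closure p).

Definition GQp : set (aut (Qpsep D)) :=
  [set s | forall x, s (Qp_incl D x) = Qp_incl D x].

(* The restriction to G_{Q_p} of this map is i_p^* *)
Definition ip_star : aut (Qpsep D) -> GQ := restr (@Qsep_stable _ (Qsep_emb D)).

(* The integral closure of Z_p in the separable closure, and its maximal
   ideal, the set of its non-units *)
Definition local_int : set (Qpsep D) := [set y |
  exists P : {poly Qp D}, [/\ P \is monic, forall i, Qp_abs (P`_i) <= 1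
    & root (map_poly (Qp_incl D) P) y]].

Definition local_max : set (Qpsep D) := [set y |
  local_int y /\ ~ exists2 z, local_int z & y * z = 1].

Definition inertia : set (aut (Qpsep D)) := [set s |
  GQp s /\ forall y, local_int y -> local_max (s y - y)].

Definition inertia2 : set GQpro2 := res_pro2 @` (ip_star @` inertia).

End Inertia.

Definition topological_generator (L : fieldType) (H : set (aut L)) (s : aut L) :=
  closure [set t | exists n, t = (s ^+ n)%g \/ t = (s ^- n)%g] = H.

(* The character chi_a of Q(sqrt a), on the Galois group of any field L that
   contains the square roots of a. *)
Definition chi (L : fieldType) (a : int) (s : aut L) : 'F_2 :=
  if `[< forall x : L, x ^+ 2 = a%:~R -> s x = x >] then 0 else 1.

Definition is_Sigma_system (loc : forall p, prime p -> local_closure p)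
    (sigma : nat -> GQpro2) (sigma21 sigma22 : GQpro2) : Prop :=
  [/\ forall p (pp : prime p), odd p ->
        topological_generator (inertia2 (loc p pp)) (sigma p),
      inertia2 (loc 2%N isT) sigma21 /\ inertia2 (loc 2%N isT) sigma22,
      chi 2 sigma21 = 1 /\ chi 2 sigma22 = 0
    & chi (-1) sigma21 = 0 /\ chi (-1) sigma22 = 1].

Definition Sigma_set (sigma : nat -> GQpro2) (sigma21 sigma22 : GQpro2) :
    set GQpro2 :=
  [set s | exists p, [/\ prime p, odd p & s = sigma p]] `|` [set sigma21; sigma22].

(* 0 is not squarefree, being divisible by 2 ^ 2 *)
Definition squarefree (a : int) : Prop :=
  forall d : nat, (d ^ 2 %| `|a|)%N -> d = 1%N.

Definition coprimeS (a b : int) : Prop := coprimez a b /\ ~ (a < 0 /\ b < 0).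

Definition Prim (I : finType) : set {ffun I -> int} := [set v |
  (forall i, squarefree (v i)) /\ (forall i j, i != j -> coprimeS (v i) (v j))].

Fixpoint carrier (n : nat) : finType :=
  if n is m.+1 then ('F_2 * carrier m)%type else unit.

(* The sequence starts at 0: [theta i] is the cocycle on G_i that defines
   G_(i+1), and the j-th coordinate below, j < n, is the one adjoined when
   passing from G_j to G_(j+1). Only the terms [theta i] for i < r matter for
   a sequence of length r. *)
Definition cochains := forall n : nat, carrier n -> carrier n -> 'F_2.

Fixpoint gid (n : nat) : carrier n :=
  if n is m.+1 return carrier n then (0, gid m) else tt.

Fixpoint coord (n : nat) : carrier n -> nat -> 'F_2 :=
  if n is m.+1 return carrier n -> nat -> 'F_2
  then fun g j => if j == m then g.1 else coord g.2 j
  else fun _ _ => 0.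

Fixpoint gmul (theta : cochains) (n : nat) : carrier n -> carrier n -> carrier n :=
  if n is m.+1 return carrier n -> carrier n -> carrier n
  then fun g h => (g.1 + h.1 + theta m g.2 h.2, gmul theta g.2 h.2)
  else fun _ _ => tt.

Definition coboundary (T : Type) (op : T -> T -> T) (f : T -> 'F_2) (x y : T) :=
  f (op x y) - f x - f y.

Definition cochain0 (theta : cochains) (n : nat) : Prop :=
  forall g h, theta n g h = 0.

Definition admissible (theta : cochains) (r : nat) : Prop :=
  forall i, (i < r)%N ->
  [/\ forall g h k,
        theta i h k - theta i (gmul theta g h) k
        + theta i g (gmul theta h k) - theta i g h = 0,
      theta i (gid i) (gid i) = 0
    & (exists f, forall g h, theta i g h = coboundary (@gmul theta i) f g h)
      <-> cochain0 theta i].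

Definition kcontinuous (L : fieldType) (T : choiceType) (f : aut L -> T) : Prop :=
  continuous (f : aut L -> discrete_topology T).

Definition Epi (theta : cochains) (n : nat) : set (GQpro2 -> carrier n) :=
  [set psi | [/\ kcontinuous psi,
    forall s t, psi (s * t)%g = gmul theta (psi s) (psi t)
    & forall g, exists s, psi s = g]].

Section PG.
Variables (theta : cochains) (Sigma : set GQpro2).

(* [phi] is a continuous 1-cochain on G_Q with coboundary psi^* theta_n *)
Definition trivialization (n : nat) (psi : GQpro2 -> carrier n) (phi : GQ -> 'F_2) :=
  kcontinuous phi /\ forall s t, coboundary *%g phi s t =
    theta (psi (res_pro2 s)) (psi (res_pro2 t)).

(* The unique such cochain on G_Q that vanishes on Sigma, as a function on
   Gal(Q^pro-2/Q), through which it factors *)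
Definition normalized_lift (n : nat) (psi : GQpro2 -> carrier n) : GQpro2 -> 'F_2 :=
  xget (fun _ => 0)
    [set phi : GQpro2 -> 'F_2 | trivialization psi (phi \o res_pro2) /\
                               forall s, Sigma s -> phi s = 0].

Definition in_span (v : nat -> int) (i : nat) : Prop :=
  exists c : nat -> 'F_2, forall s : GQ,
    chi (v i) s = \sum_(j < i | `[< cochain0 theta j >]) c j * chi (v j) s.

Fixpoint Ptilde (v : nat -> int) (n : nat) : option (GQpro2 -> carrier n) :=
  if n is i.+1 return option (GQpro2 -> carrier n) then
    if Ptilde v i is Some psi then
      if `[< ~ exists phi, trivialization psi phi >] then None
      else if `[< cochain0 theta i >] then
        if `[< in_span v i >] then None
        else Some (fun s => (chi (v i) s, psi s))
      else Some (fun s => (normalized_lift psi s + chi (v i) s, psi s))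
    else None
  else Some (fun _ => tt).

Definition nontriv (n : nat) : finType := {g : carrier n | g != gid n}.

Definition Pow (r : nat) (v : {ffun nontriv r -> int}) (j : nat) : int :=
  \prod_(g : nontriv r | coord (val g) j == 1) v g.

(* [None] is the extra symbol *)
Definition PG (r : nat) (v : {ffun nontriv r -> int}) : option (GQpro2 -> carrier r) :=
  Ptilde (Pow v) r.

Definition Prim_solv (r : nat) : set {ffun nontriv r -> int} :=
  @Prim (nontriv r) `&` @PG r @^-1` (Some @` @Epi theta r).

End PG.

(* Main.v *)
(* A lift of an epimorphism onto G_i to one onto G_(i+1), if there is one, is
   unique up to adding a continuous character to F_2. By Kummer theory these
   characters are the chi_a, a squarefree, and a is determined by the values of
   chi_a on Sigma: for an odd prime p, chi_a(sigma_p) = 1 iff p divides a, and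
   then sigma_2(1) and sigma_2(2) detect the factor 2 and the sign. A lift has
   finite ramification, so it vanishes on almost all sigma_p and can be
   normalized to vanish on Sigma by adding a suitable chi_a. Hence every
   epimorphism onto G comes from exactly one tuple of squarefree integers, and
   such tuples correspond to Prim by attaching a prime p (or the sign) to the
   element g of G whose coordinates tell which entries p divides.

   The local input is that inertia at p moves sqrt a when p exactly divides a.
   Let w = sqrt a. If w were a polynomial in a root of unity z of order prime to
   p, Lagrange interpolation at the conjugates of z, whose differences are units,
   would make w / p integral. So there is an automorphism with w |-> -w that
   fixes all such roots of unity; and it lies in the inertia group because every
   unit of the local integers is congruent to such a root of unity. *)
From HB Require Import structures.
Require Import Defs.
From mathcomp Require Import all_boot all_order all_algebra all_field.
From mathcomp Require Import all_classical all_reals topology.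
From mathcomp Require Import ring fingroup pgroup.
From mathcomp Require cyclic.

Set Implicit Arguments.
Unset Strict Implicit.
Unset Printing Implicit Defensive.

Import Order.TTheory GRing.Theory Num.Theory.
Local Open Scope classical_set_scope.
Local Open Scope ring_scope.

(** * Extending partial automorphisms of an algebraically closed field *)

Section FieldGraph.
Variable L : fieldType.
Implicit Types (G : set (L * L)) (x y : L * L).

(* The graph of an isomorphism between two subfields of L. Encoding partial
   automorphisms as subsets of L * L makes the union of a chain a plain union,
   as needed for Zorn's lemma. *)
Record field_graph := FieldGraph {
  fg_set :> L * L -> Prop;
  fg1 : fg_set (1, 1);
  fgB : forall x y, fg_set x -> fg_set y -> fg_set (x.1 - y.1, x.2 - y.2);
  fg_div : forall x y, fg_set x -> fg_set y -> fg_set (x.1 / y.1, x.2 / y.2);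
  fg_fun : forall b : L, fg_set (0, b) -> b = 0 }.

Definition fg_dom (G : field_graph) : {pred L} :=
  fun a => `[< exists b, G (a, b) >].

Lemma fg_dom_divring_closed (G : field_graph) : divring_closed (fg_dom G).
Proof.
split=> [|a b /asboolP[a' Ga] /asboolP[b' Gb]|a b /asboolP[a' Ga] /asboolP[b' Gb]];
  apply/asboolP.
- by exists 1; exact: fg1.
- by exists (a' - b'); exact: (fgB Ga Gb).
- by exists (a' / b'); exact: (fg_div Ga Gb).
Qed.

HB.instance Definition _ (G : field_graph) :=
  GRing.isDivringClosed.Build L (fg_dom G) (fg_dom_divring_closed G).

Record fg_field (G : field_graph) :=
  FgField { fg_val : L; _ : fg_val \in fg_dom G }.

HB.instance Definition _ (G : field_graph) := [isSub for @fg_val G].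
HB.instance Definition _ (G : field_graph) := [Choice of fg_field G by <:].
HB.instance Definition _ (G : field_graph) :=
  [SubChoice_isSubIntegralDomain of fg_field G by <:].
HB.instance Definition _ (G : field_graph) :=
  [SubIntegralDomain_isSubField of fg_field G by <:].

Variable G : field_graph.

Lemma fg_eq a b b' : G (a, b) -> G (a, b') -> b = b'.
Proof.
move=> Gb Gb'; apply/eqP; rewrite -subr_eq0; apply/eqP/(fg_fun (f := G)).
by have := fgB Gb Gb'; rewrite /= subrr.
Qed.

Lemma fg_map_ex (a : fg_field G) : exists b, G (val a, b).
Proof. exact/asboolP/(valP a). Qed.

Definition fg_map (a : fg_field G) : L := projT1 (cid (fg_map_ex a)).

Lemma fg_mapP a : G (val a, fg_map a).
Proof. by rewrite /fg_map; case: cid. Qed.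

Lemma fgM x y : G x -> G y -> G (x.1 * y.1, x.2 * y.2).
Proof.
move=> Gx Gy; have := fg_div Gx (fg_div (fg1 G) Gy).
by rewrite /= !div1r !invrK.
Qed.

Lemma fg_map_zmod : zmod_morphism fg_map.
Proof.
move=> a b; have /= := fgB (fg_mapP a) (fg_mapP b).
by move=> /(fg_eq (fg_mapP (a - b))).
Qed.

Lemma fg_map_monoid : monoid_morphism fg_map.
Proof.
split=> [|a b]; first exact/esym/(fg_eq (fg1 G))/(fg_mapP 1).
by have /= /(fg_eq (fg_mapP (a * b))) := fgM (fg_mapP a) (fg_mapP b).
Qed.

End FieldGraph.

HB.instance Definition _ (L : fieldType) (G : field_graph L) :=
  GRing.isZmodMorphism.Build _ _ (@fg_map L G) (@fg_map_zmod L G).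
HB.instance Definition _ (L : fieldType) (G : field_graph L) :=
  GRing.isMonoidMorphism.Build _ _ (@fg_map L G) (@fg_map_monoid L G).

Lemma min_annihilator (F L : fieldType) (i : {rmorphism F -> L}) (x : L) :
  algebraicOver i x -> exists P : {poly F}, [/\ P != 0, root (map_poly i P) x &
    forall Q : {poly F}, root (map_poly i Q) x -> P %| Q].
Proof.
case=> P; have [n] := ubnP (size P); elim: n => // n IHn in P *.
rewrite ltnS => leP P0 Px.
have [H|/existsNP[Q /not_implyP[Qx /negP PQ]]] :=
  pselect (forall Q : {poly F}, root (map_poly i Q) x -> P %| Q).
  by exists P.
apply: (IHn (Q %% P)); first by rewrite (leq_trans _ leP)// ltn_modp.
  by apply: contraNN PQ => E; rewrite /dvdp (eqP E).
have := Qx; rewrite {1}(divp_eq Q P) rmorphD rmorphM rootE hornerD hornerM /=.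
by rewrite (rootP Px) mulr0 add0r.
Qed.

Section Extension.
Variables (F L : fieldType) (i : {rmorphism F -> L}).
Hypothesis L_alg : forall x : L, algebraicOver i x.
Hypothesis L_closed : forall P : {poly L}, (1 < size P)%N -> exists x, root P x.

Definition ring_graph (R : set (L * L)) :=
  [/\ forall c, R (i c, i c),
      forall x y, R x -> R y -> R (x.1 - y.1, x.2 - y.2),
      forall x y, R x -> R y -> R (x.1 * y.1, x.2 * y.2)
    & forall y, R (0, y) -> y = 0].

Lemma algebraic_inv_poly (x : L) : x != 0 ->
  exists Q : {poly F}, x * (map_poly i Q).[x] = 1.
Proof.
move=> x0; have [P] := L_alg x.
elim/poly_ind: P => [|P c IHP]; first by rewrite eqxx.
have [->|c0] := eqVneq c 0.
  rewrite polyC0 addr0 mulf_eq0 polyX_eq0 orbF => P0.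
  by rewrite rmorphM /= map_polyX rootM rootX (negbTE x0) orbF; apply: IHP.
move=> _; rewrite rmorphD rmorphM /= map_polyX map_polyC rootE !hornerE /=.
rewrite addr_eq0 => /eqP E; exists (- c^-1 *: P).
rewrite map_polyZ hornerZ rmorphN fmorphV mulrCA [x * _]mulrC E.
by rewrite mulrNN mulVf // fmorph_eq0.
Qed.

Lemma ring_graph_field (R : set (L * L)) : ring_graph R ->
  exists G : field_graph L, R = G.
Proof.
move=> [Ri RB RM Rf].
have RN x : R x -> R (- x.1, - x.2).
  by move=> /(RB (i 0, i 0) _ (Ri 0)); rewrite !rmorph0 /= !sub0r.
have RD x y : R x -> R y -> R (x.1 + y.1, x.2 + y.2).
  by move=> Rx /RN /(RB _ _ Rx); rewrite /= !opprK.
have R1 : R (1, 1) by have := Ri 1; rewrite rmorph1.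
have Rp (Q : {poly F}) x : R x -> R ((map_poly i Q).[x.1], (map_poly i Q).[x.2]).
  move=> Rx; elim/poly_ind: Q => [|Q c IHQ].
    by rewrite rmorph0 !horner0 -(rmorph0 i); exact: Ri.
  rewrite rmorphD rmorphM /= map_polyX map_polyC !hornerE /=.
  exact: (RD _ _ (RM _ _ IHQ Rx) (Ri c)).
have RV x : R x -> R (x.1^-1, x.2^-1).
  case: x => x y Rxy /=; have [x0|x0] := eqVneq x 0.
    by move: Rxy; rewrite x0 => Rxy; rewrite (Rf _ Rxy) invr0 -(rmorph0 i); exact: Ri.
  have [Q QE] := algebraic_inv_poly x0.
  have := RM _ _ Rxy (Rp Q _ Rxy); rewrite /= QE => R'.
  have := RB _ _ R' R1; rewrite /= subrr => /Rf /eqP; rewrite subr_eq0 => /eqP yE.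
  have y0 : y != 0.
    by apply: contra_eq_neq yE => ->; rewrite mul0r eq_sym oner_eq0.
  have := Rp Q _ Rxy => /=.
  have -> : (map_poly i Q).[x] = x^-1 by rewrite -[RHS]mulr1 -QE mulKf.
  by have -> : (map_poly i Q).[y] = y^-1 by rewrite -[RHS]mulr1 -yE mulKf.
have Rd x y : R x -> R y -> R (x.1 / y.1, x.2 / y.2).
  by move=> Rx /RV; apply: RM.
by exists (FieldGraph R1 RB Rd Rf).
Qed.

Lemma ring_graph_extend (R : set (L * L)) (x : L) : ring_graph R ->
  exists R', [/\ ring_graph R', R `<=` R' & exists y, R' (x, y)].
Proof.
move=> rR; have [G RG] := ring_graph_field rR; subst R.
have [Gi _ _ _] := rR.
have iG c : i c \in fg_dom G by apply/asboolP; exists (i c); exact: Gi.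
have xalg : algebraicOver (val : {rmorphism fg_field G -> L}) x.
  have [P P0 Px] := L_alg x.
  pose j c := FgField (iG c).
  have vj c : val (j c) = i c by [].
  exists (map_poly j P).
    rewrite -size_poly_eq0 size_map_inj_poly ?size_poly_eq0 //.
      by move=> a b /(congr1 val); rewrite !vj; exact: fmorph_inj.
    by apply: val_inj; rewrite vj !rmorph0.
  rewrite -map_poly_comp_id0; last exact: (rmorph0 (val : {rmorphism fg_field G -> L})).
  by rewrite (@eq_map_poly _ _ _ i).
have [P [P0 Px Pmin]] := min_annihilator xalg.
pose f : {rmorphism fg_field G -> L} := @fg_map L G.
have [y Py] : exists y, root (map_poly f P) y.
  apply: L_closed; rewrite size_map_poly ltnNge; apply: contraTN Px => /size1_polyC E.
  move: P0; rewrite E polyC_eq0 => c0.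
  by rewrite map_polyC rootC fmorph_eq0.
pose ev (Q : {poly fg_field G}) := ((map_poly val Q).[x], (map_poly f Q).[y]).
exists (range ev); split; first split.
- move=> c; exists (FgField (iG c))%:P => //; rewrite /ev !map_polyC !hornerC /=.
  by congr (_, _); apply: fg_eq (fg_mapP _) _; exact: Gi.
- by move=> _ _ [Q _ <-] [Q' _ <-]; exists (Q - Q') => //; rewrite /ev !rmorphB !hornerE.
- by move=> _ _ [Q _ <-] [Q' _ <-]; exists (Q * Q') => //; rewrite /ev !rmorphM !hornerE.
- move=> z [Q _ [/rootP Qx <-]]; have /dvdpP[q ->] := Pmin _ Qx.
  by rewrite rmorphM hornerM (rootP Py) mulr0.
- move=> [a b] Gab; have aG : a \in fg_dom G by apply/asboolP; exists b.
  exists (FgField aG)%:P => //; rewrite /ev !map_polyC !hornerC /=.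
  by congr (_, _); apply: fg_eq (fg_mapP _) _.
- by exists y, 'X => //; rewrite /ev !map_polyX !hornerX.
Qed.

Lemma closed_split (P : {poly L}) :
  {r : seq L | P = lead_coef P *: \prod_(z <- r) ('X - z%:P)}.
Proof.
apply: cid; have [n] := ubnP (size P); elim: n => // n IHn in P *.
rewrite ltnS => leP; have [sP|sP] := leqP (size P) 1.
  have [c ->] : exists c, P = c%:P by exists P`_0; exact: size1_polyC.
  by exists [::]; rewrite big_nil alg_polyC lead_coefC.
have [x /factor_theorem[Q PE]] := L_closed sP.
have Q0 : Q != 0 by apply: contraTneq sP => Q0; rewrite PE Q0 mul0r size_poly0.
have /IHn[r QE] : (size Q < n)%N.
  by move: leP; rewrite PE size_Mmonic ?monicXsubC // size_XsubC addn2.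
exists (x :: r); rewrite big_cons {1}PE {1}QE PE lead_coefM lead_coefXsubC mulr1.
by rewrite -scalerAl mulrC.
Qed.

Lemma ring_graph_aut (R0 : set (L * L)) : ring_graph R0 ->
  exists s : aut L, (forall c, s (i c) = i c) /\ forall x y, R0 (x, y) -> s x = y.
Proof.
move=> rR0.
pose P (R : set (L * L)) := R = set0 \/ ring_graph R /\ R0 `<=` R.
have [|R [PR Rmax]] := @Zorn_bigcup _ P.
  move=> C CP Ctot.
  have [[A [CA [a Aa]]]|nC] := pselect (exists A, C A /\ A !=set0); last first.
    left; apply/seteqP; split=> // z [A CA Az].
    by case: nC; exists A; split=> //; exists z.
  have good B z : C B -> B z -> ring_graph B /\ R0 `<=` B.
    by move=> /CP[-> //|].
  have [[Ai AB AM Af] RA] := good _ _ CA Aa.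
  have two x y : (\bigcup_(X in C) X) x -> (\bigcup_(X in C) X) y ->
      exists B, [/\ C B, B x, B y & ring_graph B].
    move=> [X CX Xx] [Y CY Yy]; have [XY|YX] := Ctot _ _ CX CY.
      by exists Y; split=> //; [exact: XY|exact: (good _ _ CY Yy).1].
    by exists X; split=> //; [exact: YX|exact: (good _ _ CX Xx).1].
  right; split; first split.
  - by move=> c; exists A.
  - by move=> x y Ux /(two _ _ Ux)[B [CB Bx By [_ BB _ _]]]; exists B => //; exact: BB.
  - by move=> x y Ux /(two _ _ Ux)[B [CB Bx By [_ _ BM _]]]; exists B => //; exact: BM.
  - by move=> y [B CB B0]; have [[_ _ _ Bf] _] := good _ _ CB B0; exact: Bf.
  - by move=> z R0z; exists A => //; exact: RA.
have [R0i R0B R0M R0f] := rR0.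
have [rR R0R] : ring_graph R /\ R0 `<=` R.
  have [RE|//] := PR; exfalso.
  apply: (Rmax R0); last by right; split.
  rewrite RE properEneq; split; last by [].
  by apply/eqP => E; have := R0i 0; rewrite -E.
have [Ri RB RM Rf] := rR.
have Rtot x : exists y, R (x, y).
  have [R' [rR' RR' [y R'y]]] := ring_graph_extend x rR.
  suff -> : R = R' by exists y.
  apply: contrapT => RneR'; apply: (Rmax R').
    by rewrite properEneq; split=> //; apply/eqP.
  by right; split=> //; exact: subset_trans RR'.
have [f fR] := choice Rtot.
have fE x y : R (x, y) -> f x = y.
  move=> Rxy; have := RB _ _ (fR x) Rxy; rewrite /= subrr => /Rf /eqP.
  by rewrite subr_eq0 => /eqP.
have fz : zmod_morphism f by move=> x y; apply: fE; exact: (RB _ _ (fR x) (fR y)).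
have fm : monoid_morphism f.
  split=> [|x y]; last by apply: fE; exact: (RM _ _ (fR x) (fR y)).
  by apply: fE; have := Ri 1; rewrite rmorph1.
pose fA := GRing.isZmodMorphism.Build L L f fz.
pose fM := GRing.isMonoidMorphism.Build L L f fm.
pose fRm : {rmorphism L -> L} := HB.pack f fA fM.
have fi c : fRm (i c) = i c by apply: fE; exact: Ri.
have fsurj y : exists x, f x = y.
  have [Q Q0 Qy] := L_alg y.
  have [r rE] := closed_split (map_poly i Q).
  have memr z : (z \in undup r) = root (map_poly i Q) z.
    rewrite mem_undup rE rootZ ?lead_coef_eq0 ?map_poly_eq0 //.
    by rewrite root_prod_XsubC.
  have mapr : {subset map f (undup r) <= undup r}.
    move=> _ /mapP[z + ->]; rewrite !memr => Qz.
    have := rmorph_root fRm Qz; rewrite -map_poly_comp.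
    by rewrite (@eq_map_poly _ _ _ i) // => c /=; rewrite fi.
  have umap : uniq (map f (undup r)).
    by rewrite map_inj_uniq ?undup_uniq //; exact: (fmorph_inj fRm).
  have [_ eqm] := uniq_min_size umap mapr (eq_leq (esym (size_map _ _))).
  by move: Qy; rewrite -memr -eqm => /mapP[x _ ->]; exists x.
have [g gE] := choice fsurj.
have fB : bijective fRm.
  by exists g => x; [apply: (fmorph_inj fRm); exact: gE|exact: gE].
by exists (@Aut L fRm fB); split=> // x y R0xy; apply: fE; exact: R0R.
Qed.

End Extension.

(** * Absolute values on Q_p *)

Section PadicNorm.
Variables (p : nat) (K : fieldType) (N : K -> rat).
Hypotheses (p_pr : prime p) (KN : padic_completion p N).

Let p_gt0 : 0 < p%:R :> rat. Proof. by rewrite ltr0n prime_gt0. Qed.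
Let p_gt1 : 1 < p%:R :> rat. Proof. by rewrite ltr1n prime_gt1. Qed.

Lemma padic_abs0 : N 0 = 0.
Proof.
by have := padic_ratr KN 0; rewrite -[X in ratr X]/(0%:~R) ratr_int /padic_norm eqxx.
Qed.

Lemma padic_abs_int (a : int) : a != 0 -> N a%:~R = p%:R ^- logn p `|a|.
Proof.
move=> a0; have := padic_ratr KN a%:~R.
rewrite ratr_int /padic_norm intr_eq0 (negbTE a0) numq_int denq_int logn1 expr0.
by rewrite mul1r.
Qed.

Lemma padic_abs1 : N 1 = 1.
Proof. by have /= := padic_abs_int (a := 1) isT; rewrite logn1 expr0 invr1. Qed.

Lemma padic_absN x : N (- x) = N x.
Proof.
have := padic_abs_int (a := -1) isT; rewrite abszN1 logn1 expr0 invr1 => N1.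
by rewrite -mulN1r (padicM KN) -[X in N X * _](_ : (-1)%:~R = -1) ?N1 ?mul1r.
Qed.

Lemma padic_abs_ge0 x : 0 <= N x.
Proof. by have := padicD KN x (- x); rewrite subrr padic_abs0 padic_absN maxxx. Qed.

Lemma padic_absB x y : N (x - y) <= Num.max (N x) (N y).
Proof. by rewrite -(padic_absN y); exact: (padicD KN). Qed.

Lemma padic_abs_eq0 x : (N x == 0) = (x == 0).
Proof. by apply/eqP/eqP => [/(padic_eq0 KN)|-> ] //; exact: padic_abs0. Qed.

Lemma padic_absX x n : N (x ^+ n) = N x ^+ n.
Proof.
by elim: n => [|n IHn]; rewrite ?expr0 ?padic_abs1 // !exprS (padicM KN) IHn.
Qed.

Lemma padic_absV x : N x^-1 = (N x)^-1.
Proof.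
have [->|x0] := eqVneq x 0; first by rewrite invr0 padic_abs0 invr0.
apply: (mulfI (x := N x)); first by rewrite padic_abs_eq0.
by rewrite -(padicM KN) !divff ?padic_abs1 // padic_abs_eq0.
Qed.

Lemma padic_abs_natn (n : nat) : ~~ (p %| n)%N -> N n%:R = 1.
Proof.
move=> pn; have n0 : (0 < n)%N by case: n pn; rewrite ?dvdn0.
have /= := padic_abs_int (a := n%:Z); rewrite -lt0n n0 => /(_ isT).
by rewrite -pmulrn => ->; rewrite lognE p_pr n0 (negbTE pn) invr1.
Qed.

Lemma padic_abs_p : N p%:R = p%:R^-1.
Proof.
have /= := padic_abs_int (a := p%:Z); rewrite -lt0n prime_gt0 // => /(_ isT).
by rewrite -pmulrn => ->; rewrite logn_prime // eqxx expr1.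
Qed.

Lemma padic_p_neq0 : p%:R != 0 :> K.
Proof. by rewrite -padic_abs_eq0 padic_abs_p invr_eq0 gt_eqF. Qed.

Lemma padic_abs_sum (I : Type) (r : seq I) (P : pred I) (F : I -> K) (B : rat) :
  0 <= B -> (forall i, P i -> N (F i) <= B) -> N (\sum_(i <- r | P i) F i) <= B.
Proof.
move=> B0 FB; elim/big_ind: _ => //; first by rewrite padic_abs0.
by move=> x y xB yB; rewrite (le_trans (padicD KN _ _)) // ge_max xB.
Qed.

Lemma padic_abs_approx x : x != 0 -> exists2 q : rat, N (x - ratr q) < N x &
  padic_norm p q = N x.
Proof.
rewrite -padic_abs_eq0 => x0.
have Nx : 0 < N x by rewrite lt0r x0 padic_abs_ge0.
have [q qx] := padic_dense KN x Nx; exists q => //.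
rewrite -(padic_ratr KN); apply/eqP; rewrite eq_le; apply/andP; split.
  rewrite -[ratr q](subKr x) (le_trans (padic_absB _ _)) // ge_max lexx /=.
  exact: ltW.
rewrite leNgt; apply/negP => qlt.
have := padicD KN (x - ratr q) (ratr q); rewrite subrK le_max !leNgt.
by rewrite qx qlt.
Qed.

Lemma padic_abs_lt1 x : N x < 1 -> N x <= p%:R^-1.
Proof.
have [->|x0] := eqVneq x 0; first by rewrite padic_abs0 invr_ge0 ltW.
have [q _ <-] := padic_abs_approx x0; rewrite /padic_norm; case: eqP => _.
  by rewrite invr_ge0 ltW.
rewrite ltr_pdivrMr ?exprn_gt0 // mul1r ltr_eXn2l // => lt_dn.
rewrite ler_pdivrMr ?exprn_gt0 // ler_pdivlMl // -exprS.
by rewrite ler_eXn2l.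
Qed.

Lemma padic_residue x : N x <= 1 ->
  exists (n : 'I_p) y, N y <= 1 /\ x = n%:R + p%:R * y.
Proof.
move=> x1.
suff [m mx] : exists m : int, N (x - m%:~R) <= p%:R^-1.
  have pn0 : p%:Z != 0 by rewrite -lt0n prime_gt0.
  have mp : (`|(m %% p)%Z| < p)%N.
    have := ltz_pmod m (_ : 0 < p%:Z); rewrite ltz_nat prime_gt0 // => /(_ isT).
    by rewrite -{1}[(m %% p)%Z]gez0_abs ?modz_ge0 // ltz_nat.
  exists (Ordinal mp), ((x - m%:~R) / p%:R + (m %/ p)%Z%:~R); split.
    rewrite (le_trans (padicD KN _ _)) // ge_max (padicM KN) padic_absV.
    rewrite padic_abs_p invrK -ler_pdivlMr // mul1r mx /=.
    have [->|d0] := eqVneq (m %/ p)%Z 0; first by rewrite padic_abs0.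
    by rewrite padic_abs_int // invf_le1 ?exprn_gt0 // exprn_ege1 // ltW.
  rewrite mulrDr mulrCA divff ?padic_p_neq0 // mulr1 /=.
  have mE : m%:~R = (m %/ p)%Z%:~R * p%:R + `|(m %% p)%Z|%:R :> K.
    by rewrite !pmulrn gez0_abs ?modz_ge0 // -intrM -intrD -divz_eq.
  by rewrite mE; ring.
have [x0|x0] := ltP (N x) 1.
  by exists 0; rewrite subr0; exact: padic_abs_lt1.
have Nx1 : N x = 1 by apply/eqP; rewrite eq_le x1.
have xn0 : x != 0 by rewrite -padic_abs_eq0 Nx1.
have [q xq qN] := padic_abs_approx xn0.
have q0 : q != 0 by apply: contra_eq_neq qN => ->; rewrite /padic_norm eqxx Nx1 eq_sym.
have nq0 : (0 < `|numq q|)%N by rewrite absz_gt0 numq_eq0.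
have dq0 : (0 < `|denq q|)%N by rewrite absz_gt0 denq_neq0.
have lE : logn p `|denq q| = logn p `|numq q|.
  move: qN; rewrite Nx1 /padic_norm (negbTE q0).
  move=> /(congr1 ( *%R^~ (p%:R ^+ logn p `|numq q|))); rewrite mul1r.
  rewrite divfK ?expf_neq0 ?gt_eqF // => /eqP.
  by rewrite -!natrX eqr_nat eqn_exp2l ?prime_gt1 // => /eqP.
have pd : ~~ (p %| `|denq q|)%N.
  have := coprime_num_den q; rewrite /coprime => /eqP g1.
  apply/negP => pd; have := dvdn_gcd p `|numq q| `|denq q|.
  rewrite g1 pd andbT dvdn1 eqn_leq leqNgt prime_gt1 //= => /esym.
  have: (0 < logn p `|denq q|)%N by rewrite lognE p_pr dq0 pd.
  by rewrite lE lognE p_pr nq0 /=; case: (p %| _)%N.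
have [u [v uv]] : exists u v : int, u * denq q + v * p%:Z = 1.
  have /coprimezP[[u v] /= uv] : coprimez (denq q) p%:Z.
    by rewrite coprimezE coprime_sym prime_coprime.
  by exists u, v.
have Nd : N (denq q)%:~R = 1.
  by rewrite padic_abs_int ?denq_neq0 // lognE p_pr dq0 (negbTE pd) invr1.
have dK0 : (denq q)%:~R != 0 :> K by rewrite -padic_abs_eq0 Nd oner_eq0.
exists (numq q * u).
rewrite -(subrK (ratr q) x) -addrA (le_trans (padicD KN _ _)) // ge_max.
rewrite padic_abs_lt1 ?(lt_le_trans xq) //=.
have -> : ratr q - (numq q * u)%:~R = (numq q * v)%:~R * p%:R / (denq q)%:~R :> K.
  have uvK : u%:~R * (denq q)%:~R + v%:~R * p%:R = 1 :> K.
    by rewrite (pmulrn 1 p) -!intrM -intrD uv.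
  rewrite /ratr; apply: (mulIf dK0); rewrite mulrBl !mulfVK // !intrM.
  by rewrite -[RHS]mulrA (canRL (addKr _) uvK); ring.
rewrite !(padicM KN) padic_absV Nd invr1 mulr1 padic_abs_p.
rewrite ler_piMl ?invr_ge0 ?(ltW p_gt0) //.
have [->|d0] := eqVneq (numq q * v) 0; first by rewrite padic_abs0.
by rewrite padic_abs_int // invf_le1 ?exprn_gt0 // exprn_ege1 // ltW.
Qed.

End PadicNorm.

Section PadicSeries.
Variables (p : nat) (K : fieldType) (N : K -> rat).
Hypotheses (p_pr : prime p) (KN : padic_completion p N).

Let p_gt0 : 0 < p%:R :> rat. Proof. by rewrite ltr0n prime_gt0. Qed.
Let p_gt1 : 1 < p%:R :> rat. Proof. by rewrite ltr1n prime_gt1. Qed.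

Lemma padic_series (q : nat -> K) : (forall j, N (q j) <= 1) ->
  exists c, forall k, exists c', N c' <= 1 /\
    c = \sum_(j < k) p%:R ^+ j * q j + p%:R ^+ k * c'.
Proof.
move=> q1; pose u k := \sum_(j < k) p%:R ^+ j * q j.
have tail k m : (k <= m)%N -> N (u m - u k) <= p%:R ^- k.
  elim: m => [|m IHm].
    by rewrite leqn0 => /eqP->; rewrite subrr (padic_abs0 KN) invr_ge0 exprn_ge0 // ltW.
  rewrite leq_eqVlt => /predU1P[->|].
    by rewrite subrr (padic_abs0 KN) invr_ge0 exprn_ge0 // ltW.
  rewrite ltnS => km; rewrite /u big_ord_recr /= addrAC.
  rewrite (le_trans (padicD KN _ _)) // ge_max IHm //= (padicM KN) (padic_absX KN).
  rewrite (padic_abs_p p_pr KN) exprVn (le_trans (y := p%:R ^- m)) //.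
    by rewrite ler_piMr ?invr_ge0 ?exprn_ge0 ?(ltW p_gt0).
  by rewrite lef_pV2 ?posrE ?exprn_gt0 // ler_eXn2l.
have small eps : 0 < eps -> exists k, p%:R ^- k < eps :> rat.
  move=> eps0; exists (Num.bound eps^-1).
  rewrite invf_plt ?posrE ?exprn_gt0 //.
  rewrite (lt_trans (archi_boundP _)) ?invr_ge0 ?ltW // -natrX ltr_nat.
  by rewrite ltn_expl ?prime_gt1.
have [|c uc] := padic_complete KN (u := u).
  move=> eps /small[k kE]; exists k => m n km kn; apply: le_lt_trans kE.
  rewrite -(subrK (u k) (u m)) -addrA (le_trans (padicD KN _ _)) //.
  by rewrite ge_max tail //= -(padic_absN KN) opprB tail.
exists c => k; exists ((c - u k) / p%:R ^+ k); split; last first.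
  by rewrite mulrC divfK ?expf_neq0 ?(padic_p_neq0 p_pr KN) // addrC subrK.
rewrite (padicM KN) (padic_absV KN) (padic_absX KN) (padic_abs_p p_pr KN) exprVn invrK.
rewrite -ler_pdivlMr ?exprn_gt0 // div1r.
have pk : 0 < p%:R ^- k :> rat by rewrite invr_gt0 exprn_gt0.
have [n nc] := uc _ pk; pose m := maxn n k.
rewrite -(subrK (u m) c) -addrA (le_trans (padicD KN _ _)) // ge_max.
rewrite tail ?leq_maxr // andbT -(padic_absN KN) opprB ltW // nc //.
by rewrite leq_maxl.
Qed.

End PadicSeries.

Definition zp_pred (p : nat) (K : fieldType) (N : K -> rat)
  (KN : padic_completion p N) : {pred K} := fun x => N x <= 1.

Lemma zp_subring_closed p K N KN : subring_closed (@zp_pred p K N KN).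
Proof.
split=> [|x y|x y]; rewrite !unfold_in /zp_pred ?(padic_abs1 KN) // => x1 y1.
  by rewrite (le_trans (padic_absB KN _ _)) // ge_max x1.
by rewrite (padicM KN) mulr_ile1 ?(padic_abs_ge0 KN).
Qed.

HB.instance Definition _ p (K : fieldType) N KN :=
  GRing.isSubringClosed.Build K (@zp_pred p K N KN) (@zp_subring_closed p K N KN).

Record zp (p : nat) (K : fieldType) (N : K -> rat) (KN : padic_completion p N) :=
  MkZp { zp_val : K; _ : zp_val \in zp_pred KN }.

HB.instance Definition _ p (K : fieldType) N KN := [isSub for @zp_val p K N KN].
HB.instance Definition _ p (K : fieldType) N KN := [Choice of @zp p K N KN by <:].
HB.instance Definition _ p (K : fieldType) N KN :=
  [SubChoice_isSubComNzRing of @zp p K N KN by <:].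

Lemma zpP p K N KN (c : @zp p K N KN) : N (val c) <= 1.
Proof. exact: (valP c). Qed.

Section LocalIntegers.
Variables (p : nat) (D : local_closure p).

Notation Zp := (zp (Qp_completion D)).

Definition zp_incl : {rmorphism Zp -> Qpsep D} :=
  (@Qp_incl p D \o (val : Zp -> Qp D))%FUN.

Lemma local_intE (y : Qpsep D) : local_int y <-> integralOver zp_incl y.
Proof.
split=> [[P [Pm P1 Py]]|[Q Qm Qy]].
  pose c i : Zp := MkZp (P1 i : P`_i \in zp_pred (Qp_completion D)).
  pose Q := \poly_(i < size P) c i.
  have QP : map_poly (val : Zp -> Qp D) Q = P.
    apply/polyP => i; rewrite coef_map coef_poly; case: ltnP => // leP.
    by rewrite [RHS]nth_default.
  exists Q; last by rewrite map_poly_comp QP.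
  apply/eqP/val_inj; rewrite -[RHS]/(1 : Qp D) -(eqP Pm) -QP.
  by rewrite lead_coef_map_inj //; exact: val_inj.
exists (map_poly (val : Zp -> Qp D) Q); split.
- by rewrite monicE lead_coef_map_inj ?(eqP Qm) //; exact: val_inj.
- by move=> i; rewrite coef_map; exact: zpP.
- by rewrite -map_poly_comp.
Qed.

End LocalIntegers.

(** * The local integers *)

Section CongruencesModP.
Variables (R : comNzRingType) (p : nat).
Hypothesis p_pr : prime p.
Implicit Types (x y a b : R).

Lemma expD_order2 b x m :
  exists t, (b + x) ^+ m.+1 = b ^+ m.+1 + m.+1%:R * (b ^+ m * x) + x ^+ 2 * t.
Proof.
elim: m => [|m [t IHm]]; first by exists 0; rewrite expr0 !expr1; ring.
exists (b * t + m.+1%:R * b ^+ m + x * t).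
rewrite exprSr IHm [b ^+ m.+2]exprS [b ^+ m.+1]exprS [m.+2%:R]mulrS; ring.
Qed.

Lemma exp_p_congr b s k :
  exists t, (b + p%:R ^+ k.+1 * s) ^+ p = b ^+ p + p%:R ^+ k.+2 * t.
Proof.
have p0 := prime_gt0 p_pr.
have [t] := expD_order2 b (p%:R ^+ k.+1 * s) p.-1; rewrite (prednK p0) => ->.
exists (b ^+ p.-1 * s + p%:R ^+ k * s ^+ 2 * t).
by rewrite !exprS expr0; ring.
Qed.

Lemma expD_p x y : exists t, (x + y) ^+ p = x ^+ p + y ^+ p + p%:R * t.
Proof.
case: p p_pr => // q q_pr; rewrite exprDn big_ord_recl big_ord_recr /=.
rewrite subn0 subnn bin0 binn !expr0 mulr1 mul1r !mulr1n.
exists (\sum_(i < q) (x ^+ (q.+1 - bump 0 i) * y ^+ (bump 0 i))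
                       *+ ('C(q.+1, bump 0 i) %/ q.+1)).
rewrite addrCA [RHS]addrC mulr_sumr; congr (_ + _).
apply: eq_bigr => i _; rewrite mulr_natl -mulrnA divnK //.
by rewrite prime_dvd_bin // /bump /= add1n ltnS ltn_ord.
Qed.

Lemma expB1_pX x k : odd p ->
  exists t, (x - 1) ^+ (p ^ k) = x ^+ (p ^ k) - 1 + p%:R * t.
Proof.
move=> p_odd; elim: k => [|k [t IHk]]; first by exists 0; rewrite mulr0 addr0 !expr1.
rewrite expnSr exprM IHk -[p%:R]expr1; have [t1 ->] := exp_p_congr (x ^+ (p ^ k) - 1) t 0.
have [t2 ->] := expD_p (x ^+ (p ^ k)) (-1).
exists (t2 + p%:R * t1); rewrite -exprM -signr_odd p_odd; ring.
Qed.

Definition pnil x := exists m c, x ^+ m = p%:R * c.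

Lemma pnilB x y : pnil x -> pnil y -> pnil (x - y).
Proof.
move=> [m [c xm]] [l [d yl]]; exists (m + l)%N; rewrite exprDn.
elim/big_ind: _ => [|_ _ [u ->] [v ->]|[i /= _] _]; first by exists 0; rewrite mulr0.
  by exists (u + v); rewrite mulrDr.
have [li|il] := leqP l i.
  rewrite -{2}(subnK li) exprD [(- y) ^+ l]exprNn yl -mulr_natr.
  set A := x ^+ _; set B := (- y) ^+ _; set C := 'C(_, _)%:R.
  by exists (A * (B * ((-1) ^+ l * d)) * C); ring.
have -> : (m + l - i = l - i + m)%N by rewrite addnC addnBAC // ltnW.
rewrite exprD xm -mulr_natr; set A := x ^+ _; set B := (- y) ^+ _.
by set C := 'C(_, _)%:R; exists (A * c * B * C); ring.
Qed.

End CongruencesModP.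

Definition loc_pred (p : nat) (D : local_closure p) : {pred Qpsep D} :=
  fun y => `[< local_int y >].
Arguments loc_pred {p} D.

Lemma loc_subring_closed p (D : local_closure p) : subring_closed (loc_pred D).
Proof.
split=> [|x y /asboolP/local_intE xi /asboolP/local_intE yi|
            x y /asboolP/local_intE xi /asboolP/local_intE yi];
  apply/asboolP/local_intE.
- exact: integral1.
- exact: integral_sub.
- exact: integral_mul.
Qed.

HB.instance Definition _ p (D : local_closure p) :=
  GRing.isSubringClosed.Build (Qpsep D) (loc_pred D) (loc_subring_closed D).

Record loc_ring (p : nat) (D : local_closure p) :=
  MkLoc { loc_val : Qpsep D; _ : loc_val \in loc_pred D }.

HB.instance Definition _ p (D : local_closure p) := [isSub for @loc_val p D].
HB.instance Definition _ p (D : local_closure p) := [Choice of loc_ring D by <:].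
HB.instance Definition _ p (D : local_closure p) :=
  [SubChoice_isSubComNzRing of loc_ring D by <:].

Section LocalRing.
Variables (p : nat) (D : local_closure p).
Hypothesis p_pr : prime p.

Notation K := (Qp D).
Notation N := (@Qp_abs p D).
Notation KN := (Qp_completion D).
Notation L := (Qpsep D).
Notation i := (@Qp_incl p D).
Notation Zp := (zp KN).
Notation O := (loc_ring D).

Definition loc_incl : {rmorphism O -> L} := val.

Lemma loc_int (y : O) : local_int (loc_incl y).
Proof. exact/asboolP/(valP y). Qed.

Lemma int_loc (y : L) : local_int y -> exists z : O, loc_incl z = y.
Proof. by move=> /asboolP yi; exists (MkLoc yi). Qed.

Lemma loc_incl_inj : injective loc_incl.
Proof. exact: val_inj. Qed.

Lemma zp_loc_subproof (c : Zp) : zp_incl D c \in loc_pred D.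
Proof. exact/asboolP/local_intE/integral_id. Qed.

Definition zp_loc (c : Zp) : O := MkLoc (zp_loc_subproof c).

Lemma zp_loc_zmod : zmod_morphism zp_loc.
Proof. by move=> x y; apply: loc_incl_inj; rewrite rmorphB /= !rmorphB. Qed.

Lemma zp_loc_monoid : monoid_morphism zp_loc.
Proof.
split=> [|x y]; apply: loc_incl_inj; last by rewrite rmorphM /= !rmorphM.
by rewrite rmorph1 /= !rmorph1.
Qed.

HB.instance Definition _ := GRing.isZmodMorphism.Build _ _ zp_loc zp_loc_zmod.
HB.instance Definition _ := GRing.isMonoidMorphism.Build _ _ zp_loc zp_loc_monoid.

Lemma Qpsep_pchar0 : [pchar L] =i pred0.
Proof.
by move=> q; rewrite (fmorph_pchar (@Qsep_emb p D)) pchar_num.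
Qed.

Lemma local_int_base (c : K) : local_int (i c) -> N c <= 1.
Proof.
move=> [P [Pm P1]]; rewrite fmorph_root rootE horner_coef => Pc.
rewrite leNgt; apply/negP => c1.
have c0 : 0 < N c by rewrite (lt_trans _ c1).
have [n sP] : exists n, size P = n.+1.
  by exists (size P).-1; rewrite polySpred ?monic_neq0.
have lP : P`_n = 1 by move: Pm; rewrite monicE lead_coefE sP /= => /eqP.
have [m nm] : exists m, n = m.+1.
  case: n sP lP => [|m] sP lP; last by exists m.
  by move: Pc; rewrite sP big_ord_recl big_ord0 lP expr0 addr0 mulr1 oner_eq0.
subst n; move: Pc; rewrite sP big_ord_recr /= lP mul1r addrC addr_eq0 => /eqP E.
have : N c ^+ m.+1 <= N c ^+ m.
  rewrite -(padic_absX KN) E (padic_absN KN).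
  apply: (padic_abs_sum KN) => [|j _]; first by rewrite exprn_ge0 // ltW.
  rewrite (padicM KN) (padic_absX KN) (le_trans (y := N c ^+ j)) //.
    by rewrite ler_piMl ?exprn_ge0 // ltW.
  by rewrite ler_eXn2l // -ltnS.
by rewrite exprS ger_pMl ?exprn_gt0 // leNgt c1.
Qed.

Lemma loc_p_nonunit (c : O) : p%:R * c <> 1.
Proof.
move=> /(congr1 loc_incl); rewrite rmorphM rmorph_nat rmorph1 => E.
have pi0 : p%:R != 0 :> K := padic_p_neq0 p_pr KN.
have E' : loc_incl c = i (p%:R^-1).
  have p0 : p%:R != 0 :> L by rewrite -(rmorph_nat i) fmorph_eq0.
  by rewrite fmorphV rmorph_nat (canRL (mulKf p0) E) mulr1.
have := local_int_base (_ : local_int (i (p%:R^-1))).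
rewrite -E' (padic_absV KN) (padic_abs_p p_pr KN) invrK => /(_ (loc_int c)).
by rewrite leNgt ltr1n prime_gt1.
Qed.

Lemma clear_denominators (Q : {poly K}) :
  exists m (Q' : {poly Zp}), map_poly val Q' = (p%:R ^+ m) *: Q.
Proof.
have [m mQ] : exists m, forall j, N (p%:R ^+ m * Q`_j) <= 1.
  elim/poly_ind: Q => [|Q c [m IHm]].
    by exists 0%N => j; rewrite coef0 mulr0 (padic_abs0 KN).
  have p0 : 0 < p%:R :> rat by rewrite ltr0n prime_gt0.
  have pk k x : N (p%:R ^+ k * x) = p%:R ^- k * N x.
    by rewrite (padicM KN) (padic_absX KN) (padic_abs_p p_pr KN) exprVn.
  have [n nc] : exists n, N (p%:R ^+ n * c) <= 1.
    exists (Num.bound (N c)); rewrite pk mulrC ler_pdivrMr ?exprn_gt0 // mul1r.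
    rewrite ltW // (lt_trans (archi_boundP (padic_abs_ge0 KN _))) //.
    by rewrite -natrX ltr_nat ltn_expl ?prime_gt1.
  exists (m + n)%N => j; rewrite coefD coefMX coefC exprD.
  have pX1 k : N (p%:R ^+ k) <= 1.
    rewrite -[X in N X]mulr1 pk (padic_abs1 KN) mulr1 invf_le1 ?exprn_gt0 //.
    by rewrite exprn_ege1 // ler1n prime_gt0.
  case: j => [|j] /=; rewrite ?add0r ?addr0.
    by rewrite -mulrA (padicM KN) mulr_ile1 ?(padic_abs_ge0 KN).
  by rewrite mulrAC (padicM KN) mulr_ile1 ?(padic_abs_ge0 KN).
exists m; pose c j : Zp := MkZp (mQ j : _ \in zp_pred KN).
exists (\poly_(j < size Q) c j); apply/polyP => j.
rewrite coef_map coefZ coef_poly; case: ltnP => // lej.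
by rewrite [RHS](_ : _ = 0) // nth_default ?mulr0.
Qed.

Lemma loc_p_separated (x : O) :
  (forall k, exists z, x = p%:R ^+ k * z) -> x = 0.
Proof.
move=> xp; apply/eqP/negPn/negP => x0.
have ix0 : loc_incl x != 0.
  by apply: contra_neq x0 => x0; apply: loc_incl_inj; rewrite x0 rmorph0.
have [|Q QE] := algebraic_inv_poly (i := i) _ ix0.
  move=> y; have [P Ps Py] := Qpsep_separable y.
  by exists P => //; exact: separable_poly_neq0.
have [m [Q' Q'E]] := clear_denominators Q.
have [z xz] := xp m.+1.
have p0 : p%:R != 0 :> L.
  by rewrite -(rmorph_nat i) fmorph_eq0; exact: (padic_p_neq0 p_pr KN).
apply: (@loc_p_nonunit (z * (map_poly zp_loc Q').[x])).
apply: loc_incl_inj; apply: (mulfI (expf_neq0 m p0)).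
rewrite rmorph1 mulr1 !rmorphM rmorph_nat -horner_map -map_poly_comp /=.
rewrite (_ : map_poly _ Q' = p%:R ^+ m *: map_poly i Q); last first.
  by rewrite -(rmorph_nat i) -rmorphXn -map_polyZ -Q'E -map_poly_comp.
rewrite hornerZ -[loc_val z]/(loc_incl z) -[loc_val x]/(loc_incl x).
have xz' : loc_incl x = p%:R ^+ m * p%:R * loc_incl z.
  by rewrite {1}xz rmorphM rmorphXn rmorph_nat exprSr.
move: (map_poly i Q).[_] QE => q QE.
by rewrite !mulrA -xz' mulrAC QE mul1r.
Qed.

End LocalRing.

Section Dichotomy.
Variables (p : nat) (D : local_closure p).
Hypothesis p_pr : prime p.

Notation K := (Qp D).
Notation KN := (Qp_completion D).
Notation L := (Qpsep D).
Notation Zp := (zp KN).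
Notation O := (loc_ring D).

Lemma zp_series (q : nat -> Zp) : exists c : Zp, forall k, exists c' : Zp,
  c = \sum_(j < k) p%:R ^+ j * q j + p%:R ^+ k * c'.
Proof.
pose v : {rmorphism Zp -> K} := val.
have [c cE] := padic_series p_pr KN (fun j => zpP (q j)).
have c1 : c \in zp_pred KN.
  by have [c' [c'1 ->]] := cE 0%N; rewrite big_ord0 add0r expr0 mul1r.
exists (MkZp c1) => k; have [c' [c'1 c'E]] := cE k.
exists (MkZp (c'1 : c' \in zp_pred KN)); apply: val_inj.
rewrite -[LHS]/c -[RHS]/(v _) [LHS]c'E rmorphD rmorphM rmorphXn rmorph_nat.
rewrite rmorph_sum; congr (_ + _).
by apply: eq_bigr => j _; rewrite rmorphM rmorphXn rmorph_nat.
Qed.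

Lemma zp_residue (c : Zp) : exists n : 'I_p, exists c' : Zp, c = n%:R + p%:R * c'.
Proof.
pose v : {rmorphism Zp -> K} := val.
have [n [c' [c'1 E]]] := padic_residue p_pr KN (zpP c).
exists n, (MkZp (c'1 : c' \in zp_pred KN)); apply: val_inj.
by rewrite -[RHS]/(v _) rmorphD rmorphM !rmorph_nat E.
Qed.

Definition ev (y : O) : {rmorphism {poly Zp} -> O} :=
  (horner_eval y \o map_poly (@zp_loc p D))%FUN.

Lemma evE y Q : ev y Q = (map_poly (@zp_loc p D) Q).[y]. Proof. by []. Qed.

Lemma evX y : ev y 'X = y. Proof. by rewrite evE map_polyX hornerX. Qed.

Lemma ev_coef y (Q : {poly Zp}) d : (size Q <= d)%N ->
  ev y Q = \sum_(j < d) zp_loc Q`_j * y ^+ j.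
Proof.
move=> Qd; rewrite evE (@horner_coef_wide _ d) ?(leq_trans (size_poly _ _)) //.
by apply: eq_bigr => j _; rewrite coef_map.
Qed.

Lemma ev_monic (y : O) : exists P : {poly Zp}, P \is monic /\ ev y P = 0.
Proof.
have /local_intE[P Pm Py] := loc_int y; exists P; split=> //.
apply: loc_incl_inj; rewrite rmorph0 -(rootP Py) evE -horner_map -map_poly_comp.
by congr _.[_]; apply: eq_map_poly.
Qed.

Lemma ev_reduce (y : O) : exists d, forall Q, 
  exists2 Q' : {poly Zp}, (size Q' <= d)%N & ev y Q = ev y Q'.
Proof.
have [P [Pm Py]] := ev_monic y; exists (size P) => Q.
exists (Pdiv.Ring.rmodp Q P).
  by rewrite ltnW // Pdiv.Ring.ltn_rmodpN0 // monic_neq0.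
by rewrite {1}(Pdiv.RingMonic.rdivp_eq Pm Q) rmorphD rmorphM Py mulr0 add0r.
Qed.

Lemma loc_series (y : O) (Q : nat -> {poly Zp}) : exists x : O, forall k,
  exists z : O, x = \sum_(j < k) p%:R ^+ j * ev y (Q j) + p%:R ^+ k * z.
Proof.
have [d dE] := ev_reduce y.
have /choice[R RE] j : exists R : {poly Zp}, (size R <= d)%N /\ ev y (Q j) = ev y R.
  by have [R] := dE (Q j); exists R.
have /choice[c cE] l := zp_series (fun j => (R j)`_l).
exists (\sum_(l < d) zp_loc (c l) * y ^+ l) => k.
have /choice[c' c'E] l := cE l k.
exists (\sum_(l < d) zp_loc (c' l) * y ^+ l).
under [X in X + _]eq_bigr do rewrite (RE _).2 (ev_coef _ (RE _).1) mulr_sumr.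
rewrite exchange_big mulr_sumr -big_split; apply: eq_bigr => l _ /=.
rewrite (c'E l) rmorphD rmorphM rmorphXn rmorph_nat rmorph_sum mulrDl mulr_suml mulrA.
by congr (_ + _); apply: eq_bigr => j _; rewrite rmorphM rmorphXn rmorph_nat mulrA.
Qed.

Lemma power_congr (y : O) : exists a n T, (0 < n)%N /\
  y ^+ (a + n) = y ^+ a + p%:R * ev y T.
Proof.
have [d dE] := ev_reduce y.
have /choice[R RE] k : exists R : {poly Zp}, (size R <= d)%N /\ y ^+ k = ev y R.
  by have [R Rd RE] := dE 'X^k; exists R; rewrite -RE rmorphXn evX.
have /choice[r rE] c : exists nc : 'I_p * Zp, c = nc.1%:R + p%:R * nc.2.
  by have [n [c' E]] := zp_residue c; exists (n, c').
pose f k : {ffun 'I_d -> 'I_p} := [ffun l => (r (R k)`_(nat_of_ord l)).1].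
have [k1 [k2 [k12 fE]]] : exists k1 k2, (k1 < k2)%N /\ f k1 = f k2.
  pose n := #|{ffun 'I_d -> 'I_p}|; pose g (k : 'I_n.+1) := f k.
  have /injectiveP : ~ injective g.
    by move=> /leq_card; rewrite card_ord ltnn.
  move=> /injectivePn[k1 [k2 k12 gE]].
  have [lt|lt|/val_inj E] := ltngtP k1 k2.
  - by exists k1, k2.
  - by exists k2, k1.
  - by rewrite E eqxx in k12.
pose T := \poly_(l < d) ((r (R k2)`_l).2 - (r (R k1)`_l).2).
exists k1, (k2 - k1)%N, T; rewrite subn_gt0 k12 subnKC 1?ltnW //; split=> //.
rewrite !(RE _).2 !(@ev_coef _ _ d) ?(RE _).1 ?size_poly // mulr_sumr -big_split.
apply: eq_bigr => l _ /=; rewrite coef_poly ltn_ord.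
rewrite {1}[(R k2)`_l]rE {1}[(R k1)`_l]rE.
have := congr1 (fun h : {ffun 'I_d -> 'I_p} => h l) fE; rewrite !ffunE => ->.
by rewrite !rmorphD rmorphN !rmorphM !rmorph_nat /=; ring.
Qed.

Lemma power_idem (y : O) : exists M T, (0 < M)%N /\
  (y ^+ M) ^+ 2 = y ^+ M + p%:R * ev y T.
Proof.
have [a [n [T [n0 aE]]]] := power_congr y.
have step m t : exists T', y ^+ (a + m + n * t) = y ^+ (a + m) + p%:R * ev y T'.
  elim: t => [|t [T' IHt]]; first by exists 0; rewrite muln0 addn0 rmorph0 mulr0 addr0.
  exists (T' + T * 'X^(m + n * t)); rewrite mulnS addnACA.
  rewrite exprD aE mulrDl -exprD addnA IHt rmorphD rmorphM rmorphXn evX.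
  by ring.
exists (n * a.+1)%N; have [T' T'E] := step (n * a.+1 - a)%N a.+1.
exists T'; rewrite muln_gt0 n0; split=> //.
have aM : (a <= n * a.+1)%N by rewrite (leq_trans (leqnSn a)) // leq_pmull.
by move: T'E; rewrite subnKC // exprD expr2.
Qed.

(* If y ^+ M is idempotent mod p, the powers y ^+ (M * p ^ k) converge in Z_p[y]
   to an idempotent of the field, 0 or 1. This is the only use of completeness;
   it replaces Hensel's lemma. *)
Lemma loc_dichotomy (y : O) : pnil p y \/
  (exists M c, (0 < M)%N /\ y ^+ M = 1 + p%:R * c) /\ exists z, y * z = 1.
Proof.
have [M [T0 [M0 ME]]] := power_idem y.
pose e k := y ^+ (M * p ^ k).
have eS k : e k.+1 = e k ^+ p by rewrite /e expnSr mulnA exprM.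
have evp k T : ev y (p%:R ^+ k * T) = p%:R ^+ k * ev y T.
  by rewrite rmorphM rmorphXn rmorph_nat.
have idem k : exists T, e k ^+ 2 = e k + p%:R ^+ k.+1 * ev y T.
  elim: k => [|k [T IHk]]; first by exists T0; rewrite /e expn0 muln1 expr1.
  have [T' T'E] := exp_p_congr p_pr 'X^(M * p ^ k) T k; exists T'.
  have := congr1 (ev y) T'E.
  rewrite rmorphXn !rmorphD !evp !rmorphXn evX -/(e k) -IHk.
  by rewrite eS exprAC => ->.
have idemX k m : exists T, e k ^+ m.+1 = e k + p%:R ^+ k.+1 * ev y T.
  have [T TE] := idem k; elim: m => [|m [T' IHm]].
    by exists 0; rewrite rmorph0 mulr0 addr0 expr1.
  exists (T + T' * 'X^(M * p ^ k)); rewrite exprSr IHm mulrDl -expr2 TE.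
  by rewrite rmorphD rmorphM rmorphXn evX -/(e k); ring.
have /choice[T TE] k : exists T, e k.+1 = e k + p%:R ^+ k.+1 * ev y T.
  by have [T] := idemX k p.-1; rewrite prednK ?prime_gt0 // -eS; exists T.
pose Q k := if k is k'.+1 then T k' else 'X^M.
have [x xE] := loc_series y Q.
have sumE k : \sum_(j < k.+1) p%:R ^+ j * ev y (Q j) = e k.
  elim: k => [|k IHk]; last by rewrite big_ord_recr IHk /= TE.
  by rewrite big_ord1 expr0 mul1r [Q _]/= rmorphXn evX /e expn0 muln1.
have {}xE k : exists z, x = e k + p%:R ^+ k.+1 * z.
  by have [z ->] := xE k.+1; exists z; rewrite sumE.
have xx : x ^+ 2 - x = 0.
  apply: (loc_p_separated p_pr) => k; have [z ->] := xE k; have [T' T'E] := idem k.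
  exists (p%:R * (ev y T' + e k * z *+ 2 + p%:R ^+ k.+1 * z ^+ 2 - z)).
  rewrite sqrrD T'E exprSr; ring.
have [z0] := xE 0%N; rewrite /e expn0 muln1 expr1 => x0.
have := congr1 (@loc_incl p D) xx.
rewrite rmorph0 rmorphB rmorphXn expr2 -{3}[loc_incl D x]mulr1 -mulrBr.
move=> /eqP; rewrite mulf_eq0 => /orP[/eqP x0'|].
  have {}x0' : x = 0 by apply: loc_incl_inj; rewrite x0' rmorph0.
  left; exists M, (- z0); rewrite mulrN; apply/eqP; rewrite -addr_eq0.
  by rewrite -x0 x0'.
rewrite subr_eq0 => /eqP x1; have {}x1 : x = 1 by apply: loc_incl_inj; rewrite x1 rmorph1.
have yM : y ^+ M = 1 + p%:R * (- z0).
  by rewrite mulrN; apply/eqP; rewrite eq_sym subr_eq -x0 x1.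
right; split; first by exists M, (- z0).
have [u uE] := loc_series z0 (fun j => 'X^j).
exists (y ^+ M.-1 * u); rewrite mulrA -exprS prednK // yM; apply/eqP; rewrite -subr_eq0.
apply/eqP/(loc_p_separated p_pr) => k; have [t ->] := uE k.
exists ((1 + p%:R * - z0) * t - z0 ^+ k).
have -> : \sum_(j < k) p%:R ^+ j * ev z0 'X^j = \sum_(j < k) (p%:R * z0) ^+ j.
  by apply: eq_bigr => j _; rewrite rmorphXn evX exprMn.
rewrite mulrN mulrDr -[1 - _ * z0]opprB mulNr -subrX1 exprMn; ring.
Qed.

End Dichotomy.

(** * Inertia *)

Section InertiaCriterion.
Variables (p : nat) (D : local_closure p).
Hypothesis p_pr : prime p.

Notation K := (Qp D).
Notation N := (@Qp_abs p D).
Notation KN := (Qp_completion D).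
Notation L := (Qpsep D).
Notation i := (@Qp_incl p D).
Notation O := (loc_ring D).

Lemma Qpsep_algebraic (x : L) : algebraicOver i x.
Proof.
have [P Ps Px] := Qpsep_separable x.
by exists P => //; exact: separable_poly_neq0.
Qed.

Lemma Qpsep_natr_eq0 (n : nat) : (n%:R == 0 :> L) = (n == 0)%N.
Proof. by have /pcharf0P := Qpsep_pchar0 D; apply. Qed.

Lemma Qpsep_root (P : {poly L}) : (1 < size P)%N -> exists x, root P x.
Proof.
move=> P1; have P0 : P != 0 by rewrite -size_poly_gt0 ltnW.
have sep := make_separable P0.
have QP : P %/ gcdp P P^`() %| P by rewrite divp_dvd ?dvdp_gcdl.
have [|x Qx] := Qpsep_closed sep; last first.
  by have /dvdpP[q E] := QP; exists x; rewrite E rootM Qx orbT.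
rewrite ltnNge; apply/negP => /size1_polyC QE.
have : P %| P^`().
  rewrite (dvdp_trans _ (dvdp_gcdr P P^`())) //.
  have := divpK (dvdp_gcdl P P^`()); rewrite QE mul_polyC => {1}<-.
  by rewrite dvdpZl ?dvdpp // -polyC_eq0 -QE; exact: separable_poly_neq0.
move=> /dvdp_leq; have [P'0 _|P'0 /(_ isT)] := eqVneq P^`() 0; last first.
  by rewrite leqNgt lt_size_deriv.
have := congr1 (fun q : {poly L} => q`_(size P).-2) P'0.
rewrite coef0 coef_deriv; case sP: (size P) P1 => [|[|m]] //= _.
move=> /eqP; rewrite -mulr_natr mulf_eq0 Qpsep_natr_eq0 orbF => /eqP Pm.
by have := lead_coef_eq0 P; rewrite lead_coefE sP /= Pm eqxx (negbTE P0).
Qed.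

Lemma loc_predP (y : L) : reflect (local_int y) (y \in loc_pred D).
Proof. exact: asboolP. Qed.

Lemma loc_pred_monic (P : {poly L}) (y : L) : P \is monic ->
  (forall j, P`_j \in loc_pred D) -> root P y -> y \in loc_pred D.
Proof.
move=> Pm Pi Py; apply/loc_predP/local_intE.
apply: integral_root_monic Pm Py _; apply/integral_poly => j.
exact/local_intE/loc_predP.
Qed.

Lemma loc_pred_base (c : K) : (i c \in loc_pred D) = (N c <= 1).
Proof.
apply/loc_predP/idP => [|c1]; first exact: local_int_base.
apply/local_intE; exact: (integral_id (zp_incl D) (MkZp (c1 : c \in zp_pred KN))).
Qed.

Lemma loc_pred_root (n : nat) (y c : L) : (0 < n)%N ->
  c \in loc_pred D -> y ^+ n = c -> y \in loc_pred D.
Proof.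
move=> n0 ci yn; apply: (loc_pred_monic (monicXnsubC c n0)).
  by move=> j; rewrite coefB coefXn coefC rpredB //; case: eqP; rewrite ?rpred0 ?rpred1.
by rewrite rootE !hornerE yn subrr.
Qed.

Lemma loc_pred_unity (n : nat) (z : L) : (0 < n)%N -> z ^+ n = 1 -> z \in loc_pred D.
Proof. by move=> n0; apply: loc_pred_root; rewrite ?rpred1. Qed.

Lemma loc_pnil_max (t : O) : pnil p t -> local_max (loc_incl D t).
Proof.
move=> [m [c tm]]; split; first exact: loc_int.
move=> [_ /int_loc[z <-]]; rewrite -rmorphM -(rmorph1 (loc_incl D)).
move=> /loc_incl_inj tz; apply: (@loc_p_nonunit p D p_pr (c * z ^+ m)).
by rewrite mulrA -tm -exprMn tz expr1n.
Qed.

Lemma GQp_loc (s : aut L) (y : O) : GQp s ->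
  exists y' : O, loc_incl D y' = s (loc_incl D y).
Proof.
move=> sK; apply: int_loc; have [P [Pm P1 Py]] := loc_int y; exists P; split=> //.
have := rmorph_root (aut_val s) Py; rewrite -map_poly_comp.
by rewrite (@eq_map_poly _ _ _ i) // => c /=; rewrite sK.
Qed.

Lemma GQp_pnil (s : aut L) (y y' : O) : GQp s ->
  loc_incl D y' = s (loc_incl D y) -> pnil p y -> pnil p y'.
Proof.
move=> sK yy' [m [c ym]]; have [c' c'E] := GQp_loc c sK.
exists m, c'; apply: loc_incl_inj.
rewrite rmorphXn yy' rmorphM c'E rmorph_nat -rmorphXn -rmorphXn ym.
by rewrite !rmorphM !rmorph_nat.
Qed.

(* Some root of unity r of order prime to p makes y - r nilpotent mod p, hence
   also s y - y = s (y - r) - (y - r). *)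
Lemma roots_of_unity_inertia (s : aut L) : odd p -> GQp s ->
  (forall n z, ~~ (p %| n)%N -> z ^+ n = 1 -> s z = z) -> inertia s.
Proof.
move=> p_odd sK s1; split=> // _ /int_loc[y <-].
have [y' y'E] := GQp_loc y sK.
rewrite -y'E -rmorphB; apply: loc_pnil_max.
suff [r [r' [rE yr]]] : exists r r' : O, loc_incl D r' = s (loc_incl D r) /\
    r' = r /\ pnil p (y - r).
  case: yr => r'r yr; subst r'; rewrite -(subrKA r).
  rewrite -[r - y]opprB -[X in X - _](_ : y' - r = _) //; apply: pnilB => //.
  by apply: (GQp_pnil sK _ yr); rewrite !rmorphB y'E rE.
have [yn|[[M [c [M0 yM]]] _]] := loc_dichotomy p_pr y.
  by exists 0, 0; rewrite subr0 !rmorph0.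
pose n := (M`_p^')%N; have n0 : (0 < n)%N by exact: part_gt0.
have pn : ~~ (p %| n)%N.
  by rewrite -prime_coprime // (@pnat_coprime p) ?pnat_id // part_pnat.
have [k Mk] : exists k, M = (n * p ^ k)%N.
  by exists (logn p M); rewrite -p_part mulnC partnC.
have [t tE] := expB1_pX p_pr (y ^+ n) k p_odd.
have {}tE : (y ^+ n - 1) ^+ (p ^ k) = p%:R * (c + t).
  by rewrite tE -exprM -Mk yM mulrDr [1 + _]addrC addrK.
have [rs rsE] := closed_split Qpsep_root ('X^n - 1).
have rsr r : r \in rs -> r ^+ n = 1.
  move=> rrs; apply/eqP; rewrite -subr_eq0; have : root ('X^n - 1) r.
    by rewrite rsE rootZ ?lead_coef_eq0 ?monic_neq0 ?monicXnsubC // root_prod_XsubC.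
  by rewrite rootE !hornerE.
have prodE : loc_incl D (y ^+ n - 1) = \prod_(r <- rs) (loc_incl D y - r).
  have := congr1 (fun q : {poly L} => q.[loc_incl D y]) rsE.
  rewrite (eqP (monicXnsubC 1 n0)) scale1r horner_prod !hornerE.
  rewrite rmorphB rmorphXn rmorph1 => ->.
  by apply: eq_bigr => r _; rewrite !hornerE.
apply: contrapT => nr.
have [u uE] : exists u : O, \prod_(r <- rs) (loc_incl D y - r) * loc_incl D u = 1.
  elim: rs {rsE prodE} rsr => [|r rs IHrs] rsr.
    by exists 1; rewrite big_nil rmorph1 mulr1.
  have [|u uE] := IHrs; first by move=> q qrs; apply: rsr; rewrite inE qrs orbT.
  have rn : r ^+ n = 1 by apply: rsr; rewrite inE eqxx.
  have /loc_predP/int_loc[r0 r0E] := loc_pred_unity n0 rn.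
  have [yr|[_ [v vE]]] := loc_dichotomy p_pr (y - r0).
    by case: nr; exists r0, r0; rewrite r0E (s1 n).
  exists (v * u); rewrite big_cons rmorphM -r0E -rmorphB mulrACA uE mulr1.
  by rewrite -rmorphM vE rmorph1.
apply: (@loc_p_nonunit p D p_pr ((c + t) * u ^+ (p ^ k))).
rewrite mulrA -tE -exprMn; apply: loc_incl_inj.
by rewrite rmorphXn rmorphM prodE uE expr1n rmorph1.
Qed.

End InertiaCriterion.

Section Ramification.
Variables (p : nat) (D : local_closure p).
Hypothesis p_pr : prime p.

Notation K := (Qp D).
Notation N := (@Qp_abs p D).
Notation KN := (Qp_completion D).
Notation L := (Qpsep D).
Notation i := (@Qp_incl p D).
Notation O := (loc_pred D).

Lemma interpolation_integral (rs : seq L) (A : {poly L}) :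
  uniq rs -> {in rs, forall r, r \in O} ->
  {in rs &, forall r r', r != r' -> (r - r')^-1 \in O} ->
  (size A <= size rs)%N -> {in rs, forall r, A.[r] \in O} ->
  forall j, A`_j \in O.
Proof.
elim: rs A => [|r rs IHrs] A /=.
  by move=> _ _ _; rewrite leqn0 size_poly_eq0 => /eqP-> _ j; rewrite coef0 rpred0.
move=> /andP[rrs urs] rsO rsV sA AO.
have [B BE] : exists B, A - A.[r]%:P = B * ('X - r%:P).
  by apply/factor_theorem; rewrite rootE !hornerE subrr.
have AE : A = B * ('X - r%:P) + A.[r]%:P by rewrite -BE subrK.
have sB : (size B <= size rs)%N.
  have [->|B0] := eqVneq B 0; first by rewrite size_poly0.
  rewrite -ltnS (leq_trans _ sA) //.
  have : (size (A - A.[r]%:P)%R <= maxn (size A) 1)%N.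
    rewrite (leq_trans (size_polyD _ _)) // geq_max leq_maxl size_polyN.
    by rewrite (leq_trans (size_polyC_leq1 _)) // leq_maxr.
  rewrite BE size_Mmonic ?monicXsubC // size_XsubC addn2 /= leq_max => /orP[//|].
  by rewrite ltnS leqn0 size_poly_eq0 (negbTE B0).
have BO : forall j, B`_j \in O.
  apply: IHrs => // [q qrs|q q' qrs q'rs|q qrs].
  - by apply: rsO; rewrite inE qrs orbT.
  - by apply: rsV; rewrite inE ?qrs ?q'rs orbT.
  - have qr : q != r by apply: contraNneq rrs => <-.
    have qr0 : q - r != 0 by rewrite subr_eq0.
    have -> : B.[q] = (A.[q] - A.[r]) * (q - r)^-1.
      by apply: (mulIf qr0); rewrite mulfVK // {1}AE !hornerE addrK.
    by rewrite rpredM ?rpredB ?AO ?rsV ?inE ?eqxx ?qrs ?orbT.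
move=> j; rewrite {1}AE mulrBr [B * r%:P]mulrC coefD coefB coefMX coefCM coefC.
have rr : r \in r :: rs by rewrite inE eqxx.
have h1 : r * B`_j \in O by apply: rpredM; [exact: rsO|exact: BO].
have h2 : (if j == 0%N then 0 else B`_j.-1) \in O by case: ifP => _; rewrite ?rpred0 ?BO.
have h3 : (if j == 0%N then A.[r] else 0) \in O.
  by case: ifP => _; rewrite ?rpred0 // AO.
exact: rpredD (rpredB h2 h1) h3.
Qed.

Lemma unity_diff_unit (n : nat) (r r' : L) : ~~ (p %| n)%N ->
  r ^+ n = 1 -> r' ^+ n = 1 -> r != r' -> (r - r')^-1 \in O.
Proof.
move=> pn rn r'n rr'.
have n0 : (0 < n)%N by case: n pn {rn r'n}; rewrite ?dvdn0.
have rU : r != 0.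
  by apply: contra_eq_neq rn => ->; rewrite expr0n gtn_eqF // eq_sym oner_eq0.
pose t := r' / r; have tn : t ^+ n = 1 by rewrite expr_div_n rn r'n divr1.
have t1 : 1 - t != 0.
  by rewrite subr_eq0 eq_sym; apply: contra_neq rr' => /(canRL (divfK rU)); rewrite mul1r.
have tO : t \in O := loc_pred_unity n0 tn.
have rO : r^-1 \in O by apply: (loc_pred_unity n0); rewrite exprVn rn invr1.
have rr'E : r - r' = r * (1 - t) by rewrite mulrBr mulr1 mulrC divfK.
have nL : n%:R != 0 :> L by rewrite Qpsep_natr_eq0 -lt0n.
have nO : n%:R^-1 \in O.
  rewrite -(rmorph_nat i) -fmorphV loc_pred_base (padic_absV KN).
  by rewrite (padic_abs_natn p_pr KN) // invr1.
have sumt : \sum_(k < n) t ^+ k = 0.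
  apply: (mulfI t1); rewrite mulr0 -[1 - t]opprB mulNr -subrX1 tn subrr oppr0 //.
have nE : n%:R = (1 - t) * \sum_(k < n) \sum_(j < k) t ^+ j.
  rewrite mulr_sumr (eq_bigr (fun k : 'I_n => 1 - t ^+ k)).
    by rewrite sumrB sumt subr0 sumr_const card_ord.
  by move=> k _; rewrite -[1 - t]opprB mulNr -subrX1 opprB.
have -> : (r - r')^-1 = r^-1 * (n%:R^-1 * \sum_(k < n) \sum_(j < k) t ^+ j).
  rewrite rr'E invfM; congr (_ * _); apply: (mulfI t1); rewrite divff //.
  by rewrite mulrCA -nE mulVf.
by rewrite !rpredM // rpred_sum // => k _; rewrite rpred_sum // => j _; rewrite rpredX.
Qed.

(* C takes values +- w at the conjugates of z, which differ by units, so by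
   interpolation its coefficients are in w O and thus in p Z_p, making w / p
   integral. *)
Lemma ramified_sqrt_notin (a : K) (w z : L) (n : nat) (C : {poly K}) :
  N a = p%:R^-1 -> w ^+ 2 = i a -> ~~ (p %| n)%N -> z ^+ n = 1 ->
  (map_poly i C).[z] <> w.
Proof.
move=> Na wa pn zn.
have n0 : (0 < n)%N by case: n pn {zn}; rewrite ?dvdn0.
have p0 : 0 < p%:R :> rat by rewrite ltr0n prime_gt0.
have p1 : 1 < p%:R :> rat by rewrite ltr1n prime_gt1.
have a0 : a != 0 by rewrite -(padic_abs_eq0 KN) Na invr_eq0 gt_eqF.
have w0 : w != 0.
  by apply: contra_eq_neq wa => ->; rewrite expr0n eq_sym fmorph_eq0.
have [mu [mu0 muz mumin]] := min_annihilator (Qpsep_algebraic z).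
wlog sC : C / (size C < size mu)%N => [hwlog|Cz].
  move=> Cz; apply: (hwlog (C %% mu)); first by rewrite ltn_modp.
  rewrite -Cz {2}(divp_eq C mu) rmorphD rmorphM !hornerE (rootP muz).
  by rewrite mulr0 add0r.
have [rs rsE] := closed_split (@Qpsep_root p D) (map_poly i mu).
have rs_root (Q : {poly K}) r : r \in rs -> root (map_poly i Q) z -> root (map_poly i Q) r.
  move=> rrs /mumin/dvdpP[q ->]; rewrite rmorphM /= rootM rsE.
  rewrite rootZ ?lead_coef_eq0 ?map_poly_eq0 //.
  by rewrite root_prod_XsubC rrs orbT.
have rsn r : r \in rs -> r ^+ n = 1.
  move=> rrs; have := rs_root ('X^n - 1) _ rrs; rewrite rmorphB rmorph1 /= map_polyXn.
  by rewrite !rootE !hornerE zn subrr subr_eq0 eqxx => /(_ isT)/eqP.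
have rsC r : r \in rs -> ((map_poly i C).[r]) ^+ 2 = i a.
  move=> rrs; have := rs_root (C ^+ 2 - a%:P) _ rrs.
  rewrite rmorphB rmorphXn /= map_polyC !rootE !hornerE Cz wa subrr subr_eq0 eqxx.
  by move=> /(_ isT)/eqP.
have urs : uniq rs.
  rewrite -separable_prod_XsubC.
  apply: (@dvdp_separable _ ('X^n - 1)); last first.
    by apply: separable_Xn_sub_1; rewrite Qpsep_natr_eq0 -lt0n.
  have : mu %| 'X^n - 1.
    by apply: mumin; rewrite rmorphB rmorph1 /= map_polyXn rootE !hornerE zn subrr.
  rewrite -(dvdp_map i) rmorphB rmorph1 /= map_polyXn rsE.
  by rewrite dvdpZl // lead_coef_eq0 map_poly_eq0.
have srs : (size rs).+1 = size mu.
  rewrite -(size_map_poly i mu) rsE size_scale ?size_prod_XsubC //.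
  by rewrite lead_coef_eq0 map_poly_eq0.
have CO j : w^-1 * i C`_j \in O.
  rewrite -coef_map -coefZ; apply: (interpolation_integral urs).
  - by move=> r /rsn; exact: loc_pred_unity.
  - by move=> r r' /rsn rn /rsn r'n; exact: (unity_diff_unit pn).
  - by rewrite (leq_trans (size_scale_leq _ _)) // size_map_poly -ltnS srs.
  - move=> r /rsC rC; rewrite hornerZ; apply: (@loc_pred_unity _ _ 2) => //.
    by rewrite exprMn rC exprVn wa mulVf // fmorph_eq0.
have CN j : N C`_j <= p%:R^-1.
  apply: (padic_abs_lt1 p_pr KN).
  have : w^-1 * i C`_j * (w^-1 * i C`_j) \in O by rewrite rpredM.
  rewrite mulrACA -expr2 exprVn wa -rmorphM -fmorphV -rmorphM loc_pred_base.
  rewrite (padicM KN) (padic_absV KN) Na invrK (padicM KN) -expr2.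
  rewrite -ler_pdivlMl // mulr1 => C2.
  rewrite -(ltr_pXn2r (n := 2)) ?nnegrE ?(padic_abs_ge0 KN) // expr1n.
  by rewrite (le_lt_trans C2) // invf_lt1.
have wpO : w / p%:R \in O.
  rewrite -Cz horner_coef mulr_suml rpred_sum // => j _.
  rewrite coef_map mulrAC rpredM ?rpredX ?(loc_pred_unity n0 zn) //.
  rewrite -(rmorph_nat i) -fmorphV -rmorphM loc_pred_base (padicM KN) (padic_absV KN).
  by rewrite (padic_abs_p p_pr KN) invrK -ler_pdivlMr // div1r.
have : (w / p%:R) * (w / p%:R) \in O by rewrite rpredM.
rewrite -expr2 expr_div_n wa -(rmorph_nat i) -rmorphXn -fmorphV -rmorphM loc_pred_base.
rewrite (padicM KN) Na (padic_absV KN) (padic_absX KN) (padic_abs_p p_pr KN).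
rewrite exprVn invrK exprS mulKf ?gt_eqF // expr1 leNgt p1 //.
Qed.

Lemma common_unity_root (n n' : nat) (z z' : L) : (0 < n)%N -> (0 < n')%N ->
  z ^+ n = 1 -> z' ^+ n' = 1 ->
  exists x k k', [/\ x ^+ (n * n') = 1, z = x ^+ k & z' = x ^+ k'].
Proof.
move=> n0 n'0 zn zn'; set m := (n * n')%N.
have m0 : (0 < m)%N by rewrite muln_gt0 n0.
have [rs rsE] := closed_split (@Qpsep_root p D) ('X^m - 1).
rewrite (eqP (monicXnsubC 1 m0)) scale1r in rsE.
have urs : uniq rs.
  rewrite -separable_prod_XsubC -rsE.
  by apply: separable_Xn_sub_1; rewrite Qpsep_natr_eq0 -lt0n.
have srs : (m <= size rs)%N.
  by rewrite -ltnS -(size_prod_XsubC rs id) -rsE size_XnsubC.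
have rs1 : all m.-unity_root rs.
  by apply/allP => r; rewrite unity_rootE -root_prod_XsubC -rsE rootE !hornerE subr_eq0.
have /hasP[x _ xm] := cyclic.has_prim_root m0 rs1 urs srs.
have zm : z ^+ m = 1 by rewrite exprM zn expr1n.
have zm' : z' ^+ m = 1 by rewrite /m mulnC exprM zn' expr1n.
have [k kE] := prim_rootP xm zm; have [k' kE'] := prim_rootP xm zm'.
by exists x, k, k'; split=> //; exact: prim_expr_order.
Qed.

Lemma ramified_sqrt_conj (a : K) (w : L) : N a = p%:R^-1 -> w ^+ 2 = i a ->
  exists s : aut L, [/\ GQp s, s w = - w &
    forall n z, ~~ (p %| n)%N -> z ^+ n = 1 -> s z = z].
Proof.
move=> Na wa.
pose e (A : {poly K}) (z : L) := (map_poly i A).[z].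
pose R0 : set (L * L) := [set u | exists n z A B,
  [/\ ~~ (p %| n)%N, z ^+ n = 1 & u = (e A z + w * e B z, e A z - w * e B z)]].
have eD A B z : e (A + B) z = e A z + e B z by rewrite /e rmorphD hornerD.
have eB A B z : e (A - B) z = e A z - e B z by rewrite /e rmorphB !hornerE.
have eM A B z : e (A * B) z = e A z * e B z by rewrite /e rmorphM hornerM.
have eC c z : e c%:P z = i c by rewrite /e map_polyC hornerC.
have e1 z : e 1 z = 1 by rewrite /e rmorph1 hornerC.
have e0 z : e 0 z = 0 by rewrite /e rmorph0 hornerC.
have eX z : e 'X z = z by rewrite /e map_polyX hornerX.
have eXn k A z : e A (z ^+ k) = e (A \Po 'X^k) z.
  by rewrite /e map_comp_poly horner_comp map_polyXn hornerXn.
have pn0 n : ~~ (p %| n)%N -> (0 < n)%N by case: n; rewrite ?dvdn0.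
have common u v : R0 u -> R0 v -> exists n z A B A' B',
    [/\ ~~ (p %| n)%N, z ^+ n = 1, u = (e A z + w * e B z, e A z - w * e B z) &
      v = (e A' z + w * e B' z, e A' z - w * e B' z)].
  move=> [n [z [A [B [pn zn ->]]]]] [n' [z' [A' [B' [pn' zn' ->]]]]].
  have [x [k [k' [xm -> ->]]]] := common_unity_root (pn0 _ pn) (pn0 _ pn') zn zn'.
  exists (n * n')%N, x, (A \Po 'X^k), (B \Po 'X^k), (A' \Po 'X^k'), (B' \Po 'X^k').
  by rewrite !eXn Euclid_dvdM // negb_or pn pn'.
have p1 : ~~ (p %| 1)%N by rewrite dvdn1 gtn_eqF ?prime_gt1.
have rR0 : ring_graph i R0.
  split.
  - move=> c; exists 1%N, 1, c%:P, 0; rewrite p1 expr1n; split=> //.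
    by rewrite eC e0 mulr0 addr0 subr0.
  - move=> u v Ru Rv; have [n [z [A [B [A' [B' [pn zn -> ->]]]]]]] := common _ _ Ru Rv.
    exists n, z, (A - A'), (B - B'); split=> //=; rewrite !eB.
    by congr (_, _); ring.
  - move=> u v Ru Rv; have [n [z [A [B [A' [B' [pn zn -> ->]]]]]]] := common _ _ Ru Rv.
    exists n, z, (A * A' + a%:P * (B * B')), (A * B' + B * A'); split=> //=.
    by rewrite !eD !eM eC -wa; congr (_, _); ring.
  - move=> y [n [z [A [B [pn zn [A0 ->]]]]]].
    have [B0|B0] := eqVneq (e B z) 0.
      by move: A0; rewrite B0 mulr0 addr0 subr0.
    have [Q QE] := algebraic_inv_poly (@Qpsep_algebraic p D) B0.
    case: (@ramified_sqrt_notin a w z n (- A * (Q \Po B))) => //.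
    rewrite -/(e _ z) eM /e map_comp_poly horner_comp -/(e B z) rmorphN hornerN -/(e A z).
    have -> : - e A z = w * e B z.
      by apply/eqP; rewrite eqr_oppLR -addr_eq0 A0.
    by rewrite -mulrA QE mulr1.
have [s [sK sR]] := ring_graph_aut (@Qpsep_algebraic p D) (@Qpsep_root p D) rR0.
exists s; split.
- exact: sK.
- apply: sR; exists 1%N, 1, 0, 1; rewrite p1 expr1n e0 e1; split=> //.
  by rewrite mulr1 add0r sub0r.
- move=> n z pn zn; apply: sR; exists n, z, 'X, 0; rewrite eX e0; split=> //.
  by rewrite mulr0 addr0 subr0.
Qed.

Lemma inertia_ramified (a : int) (w : L) : odd p -> logn p `|a| = 1%N ->
  w ^+ 2 = a%:~R -> exists2 s : aut L, inertia s & s w = - w.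
Proof.
move=> p_odd la wa.
have a0 : a != 0 by apply: contra_eq_neq la => ->; rewrite logn0.
have [||s [sK sw s1]] := @ramified_sqrt_conj a%:~R w.
- by rewrite (padic_abs_int KN) // la expr1.
- by rewrite rmorph_int.
by exists s => //; exact: roots_of_unity_inertia.
Qed.

Lemma inertia_unramified (a : int) (w : L) (s : aut L) : odd p -> ~~ (p %| `|a|)%N ->
  w ^+ 2 = a%:~R -> inertia s -> s w = w.
Proof.
move=> p_odd pa wa [sK sI].
have a0 : a != 0 by apply: contraNneq pa => ->; rewrite dvdn0.
have Na : N a%:~R = 1.
  by rewrite (padic_abs_int KN) // lognE p_pr absz_gt0 a0 (negbTE pa) invr1.
have wO : w \in O.
  apply: (loc_pred_root _ _ wa) => //.
  by rewrite -(rmorph_int i) loc_pred_base Na.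
have : (s w - w) * (s w + w) = 0.
  by rewrite -subr_sqr -rmorphXn wa rmorph_int subrr.
move=> /eqP; rewrite mulf_eq0 subr_eq0 => /orP[/eqP//|]; rewrite addr_eq0 => /eqP sw.
have /loc_predP/sI[_ []] := wO; rewrite sw.
have aL : a%:~R != 0 :> L.
  by rewrite -(rmorph_int i) fmorph_eq0 -(padic_abs_eq0 KN) Na oner_eq0.
have two0 : 2 != 0 :> L by rewrite Qpsep_natr_eq0.
exists (- (2 * a%:~R)^-1 * w); last first.
  have -> : (- w - w) * (- (2 * a%:~R)^-1 * w) = w ^+ 2 * 2 / (2 * a%:~R) by ring.
  by rewrite wa [_ * 2]mulrC divff ?mulf_neq0.
apply/loc_predP; rewrite rpredM ?rpredN //.
rewrite -(rmorph_int i) -(rmorph_nat i 2) -rmorphM -fmorphV loc_pred_base.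
rewrite (padic_absV KN) (padicM KN) Na mulr1 (padic_abs_natn p_pr KN) ?invr1 //.
by rewrite dvdn_prime2 //; apply: contraTneq p_odd => ->.
Qed.

End Ramification.

(** * The Krull topology *)

Section KrullTopology.
Variable L : fieldType.
Implicit Types s t : aut L.

Definition agree (X : seq L) s t := forall x, x \in X -> t x = s x.

Let PT := prod_topology (fun _ : L => discrete_topology L).

Let G (f : PT) : set_system PT :=
  filter_from [set: seq L] (fun X => [set g | forall x, x \in X -> g x = f x]).

Let G_filter f : Filter (G f).
Proof.
apply: filter_from_filter; first by exists [::].
move=> X Y _ _; exists (X ++ Y) => // g gXY; split=> x xX; apply: gXY;
  by rewrite mem_cat xX ?orbT.
Qed.

Let G_cvg f : G f --> f.
Proof.
have GF := G_filter f; apply/cvg_sup => x A; rewrite nbhsE /= => -[B [[C oC <-] Cf] BA].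
by exists [:: x] => // g gx; apply: BA; rewrite /= gx ?inE.
Qed.

Lemma nbhs_autP s (A : set (aut L)) :
  nbhs s A <-> exists X, forall t, agree X s t -> A t.
Proof.
split=> [|[X XA]].
  rewrite nbhsE => -[B [[C oC <-] Cs] BA].
  have : nbhs (aut_graph s) C by apply: open_nbhs_nbhs.
  by move=> /G_cvg[X _ XC]; exists X => t st; apply: BA; apply: XC.
apply: (filterS (P := [set t | agree X s t])); first exact: XA.
elim: X {XA} => [|x X IHX]; first by apply: filterE => t x.
have sx : nbhs s [set t : aut L | t x = s x].
  have pc : continuous ((fun f : PT => f x : discrete_topology L) \o @aut_graph L).
    move=> t; apply: continuous_comp; first exact: initial_continuous.
    exact: proj_continuous.
  exact: (pc s [set s x] (discrete_set1 _)).
near=> t => y; rewrite inE => /predU1P[->|yX].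
  by near: t.
by have : agree X s t by [near: t]; apply.
Unshelve. all: by end_near. Qed.

Lemma kcontinuousP (T : choiceType) (f : aut L -> T) :
  kcontinuous f <-> forall s, exists X, forall t, agree X s t -> f t = f s.
Proof.
split=> [fc s|fX s].
  by have /nbhs_autP[X XP] := fc s [set f s] (discrete_set1 _); exists X.
move=> A /= As; apply/nbhs_autP; have [X XP] := fX s; exists X => t /XP /= ->.
exact: nbhs_singleton As.
Qed.

Lemma closure_autP (A : set (aut L)) s :
  closure A s <-> forall X, exists2 t, A t & agree X s t.
Proof.
split=> [As X|sA B /nbhs_autP[X XB]].
  have /As[t [At st]] : nbhs s [set t | agree X s t] by apply/nbhs_autP; exists X.
  by exists t.
by have [t At /XB Bt] := sA X; exists t.
Qed.

End KrullTopology.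

(** * Number fields inside algC *)

Lemma algC_algebraic (z : algC) : algebraicOver (ratr : {rmorphism rat -> algC}) z.
Proof.
have [P [PE Pm] _] := minCpolyP z; exists P; first exact: monic_neq0.
by rewrite -PE root_minCpoly.
Qed.

Lemma algC_root (P : {poly algC}) : (1 < size P)%N -> exists x, root P x.
Proof. by move=> P1; apply/closed_rootP; rewrite neq_ltn P1 orbT. Qed.

Lemma autM (L : fieldType) (s t : aut L) x : (s * t)%g x = s (t x).
Proof. by []. Qed.

Lemma aut1 (L : fieldType) (x : L) : (1%g : aut L) x = x.
Proof. by []. Qed.

Lemma autK (L : fieldType) (s : aut L) : cancel s (s^-1)%g.
Proof. by move=> x; rewrite -autM mulVg. Qed.

Lemma autVK (L : fieldType) (s : aut L) : cancel (s^-1)%g s.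
Proof. by move=> x; rewrite -autM mulgV. Qed.

Lemma res_pro2E (s : GQ) (x : Qpro2) : Qpro2_incl (res_pro2 s x) = s (Qpro2_incl x).
Proof. exact: restrE. Qed.

Lemma res_pro2M (s t : GQ) : res_pro2 (s * t)%g = (res_pro2 s * res_pro2 t)%g.
Proof.
by apply: aut_eq => x; apply: (fmorph_inj Qpro2_incl); rewrite autM !res_pro2E.
Qed.

Lemma res_pro2_1 : res_pro2 1%g = 1%g.
Proof. by apply: aut_eq => x; apply: (fmorph_inj Qpro2_incl); rewrite res_pro2E. Qed.

Lemma res_pro2_surj (s : GQpro2) : exists t : GQ, res_pro2 t = s.
Proof.
pose e := Qpro2_incl.
have ratE c : exists x : Qpro2, e x = ratr c.
  have cP : ratr c \in pro2_pred by rewrite rpred_div ?rpred_int.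
  by exists (MkQpro2 cP).
have [|t [_ tE]] := @ring_graph_aut _ _ ratr algC_algebraic algC_root
    [set z | exists x, z = (e x, e (s x))].
  split.
  - move=> c; have [x xE] := ratE c; exists x; rewrite xE; congr (_, _).
    have d0 : (denq c)%:~R != 0 :> algC by rewrite intr_eq0 denq_neq0.
    have nd : (denq c)%:~R * x = (numq c)%:~R.
      by apply: (fmorph_inj e); rewrite rmorphM xE !rmorph_int mulrC divfK.
    apply: (mulfI d0); transitivity ((numq c)%:~R : algC).
      by have := congr1 e nd; rewrite rmorphM xE !rmorph_int.
    by have := congr1 (fun y => e (s y)) nd; rewrite !rmorphM !rmorph_int.
  - by move=> _ _ [x ->] [y ->]; exists (x - y); rewrite !rmorphB.
  - by move=> _ _ [x ->] [y ->]; exists (x * y); rewrite !rmorphM.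
  - move=> _ [x [x0 ->]]; suff -> : x = 0 by rewrite !rmorph0.
    by apply: (fmorph_inj e); exact: etrans (esym x0) (esym (rmorph0 e)).
exists t; apply: aut_eq => x; apply: (fmorph_inj e); rewrite res_pro2E.
by apply: tE; exists x.
Qed.

Lemma galois_num_field (P : {poly rat}) : P != 0 ->
  exists (K : splittingFieldType rat) (f : {rmorphism K -> algC}) (rs : seq K),
  [/\ galois 1 {:K}, <<1 & rs>>%VS = fullv &
      forall z, root (map_poly ratr P) z -> exists2 k, k \in rs & f k = z] /\
      {in rs, forall k, root (map_poly ratr P) (f k)}.
Proof.
move=> P0; have [r rE] := closed_field_poly_normal (map_poly ratr P : {poly algC}).
have rP z : root (map_poly ratr P) z = (z \in r).
  by rewrite rE rootZ ?lead_coef_eq0 ?map_poly_eq0 // root_prod_XsubC.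
have [Qs [f [rs frs gen]]] := num_field_exists r.
pose PK := map_poly (in_alg Qs) P.
have PKE : map_poly f PK = map_poly ratr P.
  by rewrite -map_poly_comp; apply: eq_map_poly => c /=; rewrite rmorphZ_num rmorph1 mulr1.
have PKr : PK %= \prod_(z <- rs) ('X - z%:P).
  rewrite -(eqp_map f) PKE rE -frs big_map rmorph_prod /=.
  under [X in _ %= X]eq_bigr do rewrite map_polyXsubC.
  by rewrite eqp_scale ?lead_coef_eq0 ?map_poly_eq0.
have split : splittingFieldFor 1 PK {:Qs} by exists rs.
have PK1 : PK \is a polyOver 1%AS.
  by apply/polyOverP => j; rewrite coef_map /= rpredZ ?rpred1.
have Qs_ax : FieldExt_isSplittingField _ Qs by constructor; exists PK.
pose K : splittingFieldType rat := HB.pack_for (splittingFieldType rat) Qs Qs_ax.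
exists K, f, rs; split; first split.
- apply/and3P; split; [exact: sub1v| |exact: normalFieldf].
  apply/separableP => x _; apply: pcharf0_separable.
  by move=> q; rewrite -(fmorph_pchar f) pchar_num.
- by [].
- by move=> z; rewrite rP -frs => /mapP[k krs ->]; exists k.
- by move=> k krs; rewrite rP -frs; apply/mapP; exists k.
Qed.

Lemma galois_num_field_over (X : seq algC) :
  exists (K : splittingFieldType rat) (f : {rmorphism K -> algC}),
  galois 1 {:K} /\ forall x, x \in X -> exists k, f k = x.
Proof.
pose P := \prod_(x <- X) sval (minCpolyP x).
have P0 : P != 0.
  rewrite monic_neq0 // /P monic_prod // => x _.
  by have [[]] := svalP (minCpolyP x).
have [K [f [rs [[galK _ Prs] _]]]] := galois_num_field P0.
exists K, f; split=> // x xX; have [|k _ <-] := Prs x; last by exists k.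
rewrite /P rmorph_prod rootE horner_prod /= prodf_seq_eq0.
apply/hasP; exists x => //=; have [[<- _] _] := svalP (minCpolyP x).
exact: root_minCpoly.
Qed.

Section Level.
Variables (K : splittingFieldType rat) (f : {rmorphism K -> algC}).
Hypothesis galK : galois 1 {:K}.

Lemma gal_lift (g : gal_of {:K}) : exists s : GQ, forall k, s (f k) = f (g k).
Proof.
have fr c : ratr c = f (c%:A) by rewrite rmorphZ_num rmorph1 mulr1.
have [|s [_ sE]] := @ring_graph_aut _ _ ratr algC_algebraic algC_root
    [set z | exists k, z = (f k, f (g k))].
  split.
  - by move=> c; exists c%:A; rewrite linearZ /= rmorph1 -fr.
  - by move=> _ _ [x ->] [y ->]; exists (x - y); rewrite !rmorphB.
  - by move=> _ _ [x ->] [y ->]; exists (x * y); rewrite !rmorphM.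
  - move=> _ [x [x0 ->]]; suff -> : x = 0 by rewrite !rmorph0.
    by apply: (fmorph_inj f); exact: etrans (esym x0) (esym (rmorph0 f)).
by exists s => k; apply: sE; exists k.
Qed.

Lemma minPoly_rat (k : K) : exists2 q : {poly rat},
  q != 0 & minPoly 1 k = map_poly (in_alg K) q.
Proof.
have /polyOver1P[q qE] := minPolyOver 1 k; exists q => //.
by rewrite -(map_poly_eq0 (in_alg K)) -qE monic_neq0 ?monic_minPoly.
Qed.

Lemma rat_poly_f (q : {poly rat}) :
  map_poly f (map_poly (in_alg K) q) = map_poly ratr q.
Proof.
by rewrite -map_poly_comp; apply: eq_map_poly => c /=; rewrite rmorphZ_num rmorph1 mulr1.
Qed.

Lemma level_stable : aut_stable f.
Proof.
move=> s k; have [q q0 qE] := minPoly_rat k.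
have : root (map_poly ratr q) (s (f k)).
  rewrite (@eq_map_poly _ _ ratr (s \o ratr)) => [|c]; last by rewrite /= fmorph_rat.
  by rewrite map_poly_comp fmorph_root -rat_poly_f fmorph_root -qE root_minPoly.
have /and3P[_ _ /normalFieldP/(_ k (memvf k))[r _ rE]] := galK.
rewrite -rat_poly_f -qE rE rmorph_prod rootE horner_prod.
rewrite prodf_seq_eq0 => /hasP[z _ /=].
by rewrite map_polyXsubC !hornerE subr_eq0 => /eqP ->; exists z.
Qed.

Lemma gal_restr (s : GQ) : exists g : gal_of {:K}, forall k, s (f k) = f (g k).
Proof.
pose u := restr level_stable s.
have us : scalable u.
  by move=> c x; rewrite rmorphZ_num -alg_num_field mulr_algl.
have ul : linear u by move=> c x y; rewrite rmorphD us.
pose uL := GRing.isLinear.Build rat K K _ u ul.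
pose ul' : {linear K -> K} := HB.pack (u : K -> K) uL.
have uE x : linfun ul' x = u x by rewrite lfunE.
have uH : kHom 1 {:K} (linfun ul').
  apply/kHom_lrmorphism; split=> [x y|]; first by rewrite !uE rmorphM.
  by rewrite uE rmorph1.
have [//|g _ gE] := kHom_to_gal _ (normalFieldf _) uH.
  by rewrite sub1v subvf.
exists g => k; have := gE k (memvf k); rewrite uE => <-.
by rewrite /u restrE.
Qed.

End Level.

Lemma lift_exp (K : splittingFieldType rat) (f : {rmorphism K -> algC})
    (s : GQ) (g : gal_of {:K}) n :
  (forall k, s (f k) = f (g k)) -> forall k, (s ^+ n)%g (f k) = f ((g ^+ n)%g k).
Proof.
move=> sg; elim: n => [|n IHn] k; first by rewrite !expg0 gal_id.
by rewrite expgSr expgS autM sg IHn galM ?memvf.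
Qed.

Lemma mem_pro2 (y : algC) (m : nat) :
  (forall s t : GQ, (s ^+ (2 ^ m))%g (t y) = t y) -> y \in pro2_pred.
Proof.
move=> ym; apply/asboolP => S SC KS.
have [P [PE Pm] Pdvd] := minCpolyP y; have P0 := monic_neq0 Pm.
have [K [f [rs [[galK gen yrs] rsP]]]] := galois_num_field P0.
have Py : root (map_poly ratr P) y by rewrite -PE root_minCpoly.
have [k krs fk] := yrs y Py.
have rs_conj r : r \in rs -> exists t : GQ, t y = f r.
  move=> /rsP Pr; have [q q0 qE] := minPoly_rat k.
  have Pq : P %| q.
    by rewrite -Pdvd -(rat_poly_f f) -qE -fk fmorph_root root_minPoly.
  have rk : root (minPoly 1 k) r.
    have /dvdpP[h hE] := Pq; rewrite qE hE rmorphM /= rootM; apply/orP; right.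
    by rewrite -(fmorph_root f) rat_poly_f.
  have /and3P[_ _ nK] := galK.
  have [g _ gk] := normalField_root_minPoly (sub1v _) nK (memvf k) rk.
  by have [t tE] := gal_lift f g; exists t; rewrite -fk tE gk.
have g2 (g : gal_of {:K}) : (g ^+ (2 ^ m))%g = 1%g.
  have [s sE] := gal_lift f g; set h := (g ^+ _)%g.
  suff : (fullv <= fixedSpace h)%VS.
    move=> /subvP h1; apply/eqP/gal_eqP => a _; rewrite gal_id.
    by apply/fixedSpaceP/h1; rewrite memvf.
  rewrite -[X in (X <= _)%VS]gen; apply/Fadjoin_seqP; split; first exact: sub1v.
  move=> r rrs; apply/fixedSpaceP; have [t tE] := rs_conj r rrs.
  by apply: (fmorph_inj f); rewrite -(lift_exp _ sE) -tE ym.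
have [n dimK] : exists n, \dim {:K} = (2 ^ n)%N.
  have := galois_dim galK; rewrite dimv1 divn1 => ->.
  have /p_natP[n nE] : (2.-group 'Gal({:K} / 1))%g; last by exists n.
  apply/pgroupP => q q_pr /(Cauchy q_pr)[g _ gq].
  have : (q %| 2 ^ m)%N by rewrite -gq cyclic.order_dvdn g2.
  by rewrite Euclid_dvdX // dvdn_prime2 // => /andP[/eqP ->].
rewrite -fk; exact: KS galK dimK k.
Qed.

Lemma Qpro2_sqrt (a : int) : exists w : Qpro2, w ^+ 2 = a%:~R.
Proof.
have wP : sqrtC (a%:~R : algC) \in pro2_pred.
  apply: (mem_pro2 (m := 1)) => s t; set w := sqrtC _; rewrite expn1.
  have : (s (t w)) ^+ 2 = (t w) ^+ 2.
    by rewrite -!rmorphXn /w sqrtCK !rmorph_int.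
  move=> /eqP; rewrite eqf_sqr expgS expg1 autM => /orP[]/eqP sw; rewrite !sw //.
  by rewrite rmorphN sw opprK.
exists (MkQpro2 wP); apply: (fmorph_inj Qpro2_incl).
by rewrite rmorphXn rmorph_int /= sqrtCK.
Qed.

(* y generates the fixed field of N, which is Galois of 2-power degree. *)
Lemma pro2_kernel (N : GQ -> Prop) (m : nat) :
  N 1%g -> (forall s t, N s -> N t -> N (s * t)%g) ->
  (forall s t, N s -> N (t^-1 * s * t)%g) ->
  (exists X, forall s, agree X 1%g s -> N s) ->
  (forall s, N (s ^+ (2 ^ m))%g) ->
  exists y : Qpro2, forall s : GQ, s (Qpro2_incl y) = Qpro2_incl y -> N s.
Proof.
move=> N1 NM NJ [X XN] N2.
have [K [f [galK XK]]] := galois_num_field_over X.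
have agreeN (s t : GQ) : (forall k, s (f k) = t (f k)) -> N t -> N s.
  move=> st Nt; rewrite -[s](mulKVg t); apply: NM => //; apply: XN => x /XK[k <-].
  by rewrite aut1 autM st autK.
pose inNG (g : gal_of {:K}) := exists s : GQ, (forall k, s (f k) = f (g k)) /\ N s.
pose NG := [set g : gal_of {:K} | `[< inNG g >]]%SET.
have NGP g : reflect (inNG g) (g \in NG).
  by rewrite inE; exact: asboolP.
have NG_group : group_set NG.
  apply/group_setP; split.
    by apply/NGP; exists 1%g; split=> // k; rewrite gal_id.
  move=> g h /NGP[s [sE Ns]] /NGP[t [tE Nt]]; apply/NGP; exists (t * s)%g.
  by split=> [k|]; [rewrite autM sE tE galM ?memvf | exact: NM].
pose E := fixedField_aspace (group NG_group).
have EN (g : gal_of {:K}) : {in E, forall a, g a = a} -> g \in NG.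
  move=> gE.
  have <- : ('Gal({:K} / E) = NG)%g by exact: (gal_fixedField (group NG_group)).
  by rewrite gal_kHom ?subvf //; apply/kAHomP => a /gE.
have NE (g : gal_of {:K}) a : g \in NG -> a \in E -> g a = a.
  by move=> gN /fixedFieldP; apply=> //; rewrite memvf.
have sepE : separable 1 E.
  by have /and3P[_ sepK _] := galK; exact: separableSr (subvf _) sepK.
pose z := separable_generator 1 E.
have Ez : <<1; z>>%VS = E := esym (eq_adjoin_separable_generator sepE (sub1v _)).
have zE : z \in E by rewrite -Ez memv_adjoin.
have fixz (s : GQ) : N s -> s (f z) = f z.
  have [g gE] := gal_restr f galK s; move=> Ns; rewrite gE (NE g) //.
  by apply/NGP; exists s.
have yP : f z \in pro2_pred.
  apply: (mem_pro2 (m := m)) => s t.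
  have /fixz := NJ _ t (N2 s); rewrite !autM => E1.
  by apply: (can_inj (autVK t)); rewrite E1 autK.
exists (MkQpro2 yP) => s sz; have [g gE] := gal_restr f galK s.
have gz : g z = z by apply: (fmorph_inj f); rewrite -gE.
have /NGP[t [tE Nt]] : g \in NG.
  apply: EN => a; rewrite -Ez => aE; apply/fixedSpaceP; move: a aE; apply/subvP.
  rewrite -[X in (X <= _)%VS]/(<<_; _>>%VS); apply/FadjoinP; split; first exact: sub1v.
  exact/fixedSpaceP.
by apply: agreeN Nt => k; rewrite gE tE.
Qed.

(** * Quadratic characters *)

Lemma F2P (c : 'F_2) : c = 0 \/ c = 1.
Proof. by case: c => [[|[|//]] ?]; [left|right]; apply: val_inj. Qed.

Lemma F2_neq0 (c : 'F_2) : c != 0 -> c = 1.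
Proof. by case: (F2P c) => ->; rewrite ?eqxx. Qed.

Lemma addF2K (c : 'F_2) : c + c = 0.
Proof. by case: (F2P c) => ->; apply: val_inj. Qed.

Lemma oppF2 (c : 'F_2) : - c = c.
Proof. by apply/eqP; rewrite eq_sym -addr_eq0 addF2K. Qed.

Definition sgF (L : fieldType) (c : 'F_2) : L := if c == 0 then 1 else -1.
Arguments sgF : clear implicits.

Lemma sgF0 L : sgF L 0 = 1. Proof. by rewrite /sgF eqxx. Qed.

Lemma sgF1 L : sgF L 1 = -1. Proof. by []. Qed.

Lemma sgFD L c d : sgF L (c + d) = sgF L c * sgF L d.
Proof.
case: (F2P c) => ->; rewrite ?add0r ?sgF0 ?mul1r // sgF1.
case: (F2P d) => ->; rewrite ?addr0 ?sgF0 ?mulr1 ?sgF1 //.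
by rewrite addF2K sgF0 mulrNN mulr1.
Qed.

Lemma rmorph_sgF (L M : fieldType) (f : {rmorphism L -> M}) c : f (sgF L c) = sgF M c.
Proof. by rewrite /sgF; case: ifP; rewrite ?rmorphN1 ?rmorph1. Qed.

Section Chi.
Variables (L : fieldType).
Hypothesis L0 : [pchar L] =i pred0.

Lemma sgF_inj (c d : 'F_2) (x : L) : x != 0 -> sgF L c * x = sgF L d * x -> c = d.
Proof.
move=> x0 /(mulIf x0).
have N1 : (1 == -1 :> L) = false.
  rewrite -subr_eq0 opprK -(natrD _ 1 1); move/pcharf0P: L0 => ->; by [].
case: (F2P c) => ->; case: (F2P d) => -> //; rewrite sgF0 sgF1 => /eqP.
  by rewrite N1.
by rewrite eq_sym N1.
Qed.

Lemma chiE (a : int) (s : aut L) (w : L) : w ^+ 2 = a%:~R -> s w = sgF L (chi a s) * w.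
Proof.
move=> wa; rewrite /chi; case: asboolP => [sw|nsw]; first by rewrite sgF0 mul1r sw.
rewrite sgF1 mulN1r; have : (s w) ^+ 2 = w ^+ 2 by rewrite -rmorphXn wa rmorph_int.
move=> /eqP; rewrite eqf_sqr => /orP[/eqP sw|/eqP //]; case: nsw => x xa.
have : x ^+ 2 == w ^+ 2 by rewrite xa wa.
by rewrite eqf_sqr => /orP[]/eqP ->; rewrite ?rmorphN sw.
Qed.

Lemma chi_unique (a : int) (s : aut L) (w : L) c :
  a != 0 -> w ^+ 2 = a%:~R -> s w = sgF L c * w -> chi a s = c.
Proof.
move=> a0 wa; rewrite (chiE s wa); apply: sgF_inj.
apply: contra_neq a0 => w0; have /eqP := wa; rewrite w0 expr0n eq_sym.
case: a {wa w0} => n; first by rewrite -pmulrn (pcharf0P L).1 // => /eqP ->.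
by rewrite NegzE mulrNz oppr_eq0 -pmulrn (pcharf0P L).1.
Qed.

End Chi.

Lemma algC_pchar0 : [pchar algC] =i pred0.
Proof. exact: pchar_num. Qed.

Lemma Qpro2_pchar0 : [pchar Qpro2] =i pred0.
Proof. by move=> q; rewrite -(fmorph_pchar Qpro2_incl) algC_pchar0. Qed.

Lemma chi_res (a : int) (s : GQ) : a != 0 -> chi a (res_pro2 s) = chi a s.
Proof.
move=> a0; have [w wa] := Qpro2_sqrt a; apply/esym.
apply: (chi_unique algC_pchar0 a0 (w := Qpro2_incl w)).
  by rewrite -rmorphXn wa rmorph_int.
by rewrite -res_pro2E (chiE _ wa) rmorphM rmorph_sgF.
Qed.

Lemma chiM (a : int) (s t : GQpro2) : a != 0 -> chi a (s * t)%g = chi a s + chi a t.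
Proof.
move=> a0; have [w wa] := Qpro2_sqrt a; apply: (chi_unique Qpro2_pchar0 a0 wa).
by rewrite autM (chiE _ wa) rmorphM rmorph_sgF (chiE _ wa) sgFD mulrA [sgF _ _ * _]mulrC.
Qed.

Lemma chi_mul (a b : int) (s : GQpro2) : a != 0 -> b != 0 ->
  chi (a * b) s = chi a s + chi b s.
Proof.
move=> a0 b0; have [w wa] := Qpro2_sqrt a; have [u ub] := Qpro2_sqrt b.
apply: (chi_unique Qpro2_pchar0 (w := w * u)); first by rewrite mulf_neq0.
  by rewrite exprMn wa ub intrM.
by rewrite rmorphM (chiE _ wa) (chiE _ ub) sgFD mulrACA.
Qed.

Lemma chi_sqr (d : int) (s : GQpro2) : d != 0 -> chi (d ^+ 2) s = 0.
Proof.
move=> d0; apply: (chi_unique Qpro2_pchar0 (w := d%:~R)); first by rewrite expf_neq0.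
  by rewrite rmorphXn.
by rewrite sgF0 mul1r rmorph_int.
Qed.

Lemma chi1 (s : GQpro2) : chi 1 s = 0.
Proof. by have := @chi_sqr 1 s isT; rewrite expr1n. Qed.

Lemma chi_agree (a : int) : a != 0 -> exists w : Qpro2, forall s t : GQpro2,
  s w = t w -> chi a s = chi a t.
Proof.
move=> a0; have [w wa] := Qpro2_sqrt a; exists w => s t st.
by apply: (chi_unique Qpro2_pchar0 a0 wa); rewrite st (chiE _ wa).
Qed.

Lemma chi_continuous (a : int) : a != 0 -> kcontinuous (chi a : GQpro2 -> 'F_2).
Proof.
move=> a0; have [w wE] := chi_agree a0; apply/kcontinuousP => s.
by exists [:: w] => t st; apply: wE; apply: st; rewrite inE.
Qed.

Lemma quadratic_character (phi : GQpro2 -> 'F_2) :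
  kcontinuous phi -> (forall s t, phi (s * t)%g = phi s + phi t) ->
  exists2 a : int, a != 0 & forall s, phi s = chi a s.
Proof.
move=> /kcontinuousP phic phiM.
have phi1 : phi 1%g = 0.
  by have := phiM 1%g 1%g; rewrite mulg1 => /eqP; rewrite eq_sym -subr_eq0 addrK => /eqP.
have [X XP] := phic 1%g.
pose psi s := phi (res_pro2 s).
have psiM s t : psi (s * t)%g = psi s + psi t by rewrite /psi res_pro2M phiM.
have [K [f [galK XK]]] := galois_num_field_over (map Qpro2_incl X).
have psi_eq (s t : GQ) : (forall k, s (f k) = t (f k)) -> psi s = psi t.
  move=> st; rewrite -[s](mulKVg t) psiM [psi (_ * s)%g](_ : _ = 0) ?addr0 //.
  rewrite -phi1; apply: XP => x /(map_f Qpro2_incl)/XK[k fk].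
  apply: (fmorph_inj Qpro2_incl).
  by rewrite res_pro2E aut1 -fk autM st autK.
have /choice[lift liftE] (g : gal_of {:K}) := gal_lift f g.
pose c g := sgF K (psi (lift g)).
(* By independence of characters some Lagrange resolvent B is nonzero, and Q(B)
   is then the quadratic field of psi. *)
have [|b _ b0] := @gal_independent_contra _ _ _ [in ('Gal({:K} / 1))%g] c 1%g (group1 _).
  by rewrite /c /sgF; case: ifP; rewrite ?oppr_eq0 oner_eq0.
set B := \sum_(_ in _) _ in b0.
have galE (g : gal_of {:K}) : g \in ('Gal({:K} / 1))%g.
  rewrite gal_kHom ?sub1v // k1HomE; apply/ahom_inP; split=> [x y _ _|].
    by rewrite rmorphM.
  by rewrite rmorph1.
have fB (s : GQ) : s (f B) = sgF algC (psi s) * f B.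
  have [h hE] := gal_restr f galK s.
  rewrite hE -(rmorph_sgF f) -rmorphM; congr (f _).
  rewrite [in LHS]/B rmorph_sum /B mulr_sumr.
  rewrite [RHS](reindex_inj (mulIg h)) /=.
  apply: eq_big => [g|g _]; first by rewrite !galE.
  rewrite rmorphM galM ?memvf // mulrA; congr (_ * _).
  rewrite /c rmorph_sgF -sgFD.
  have -> : psi (lift (g * h)%g) = psi s + psi (lift g).
    by rewrite -psiM; apply: psi_eq => k; rewrite liftE autM liftE hE galM ?memvf.
  by rewrite addrA addF2K add0r.
have sg2 (L : fieldType) d : sgF L d ^+ 2 = 1.
  by rewrite /sgF; case: ifP; rewrite ?sqrrN expr1n.
have [q qE] : exists q : rat, B ^+ 2 = q%:A.
  have : B ^+ 2 \in 1%VS.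
    rewrite -(galois_fixedField galK); apply/fixedFieldP; first exact: memvf.
    move=> g _; apply: (fmorph_inj f); have [s sE] := gal_lift f g.
    by rewrite -sE !rmorphXn fB exprMn sg2 mul1r.
  by move=> /vlineP[q ->]; exists q.
have q0 : q != 0.
  by apply: contra_eq_neq qE => ->; rewrite scale0r expf_neq0.
have d0 : denq q != 0 by rewrite denq_neq0.
exists (numq q * denq q); first by rewrite mulf_neq0 ?numq_eq0.
move=> s; have [t <-] := res_pro2_surj s; rewrite chi_res ?mulf_neq0 ?numq_eq0 //.
apply/esym/(chi_unique algC_pchar0 (w := f B * (denq q)%:~R)).
- by rewrite mulf_neq0 ?numq_eq0.
- rewrite exprMn -rmorphXn qE rmorphZ_num rmorph1 mulr1 intrM.
  by rewrite expr2 mulrA /ratr divfK // intr_eq0.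
- by rewrite rmorphM fB rmorph_int mulrA.
Qed.

(** * Ramification of quadratic characters *)

Lemma ip_starE p (D : local_closure p) (s : aut (Qpsep D)) z :
  Qsep_emb D (ip_star s z) = s (Qsep_emb D z).
Proof. exact: restrE. Qed.

Lemma almost_integral (z : algC) : exists2 n : nat, (0 < n)%N &
  forall p (D : local_closure p), prime p -> ~~ (p %| n)%N -> local_int (Qsep_emb D z).
Proof.
have [P [PE Pm] _] := minCpolyP z.
exists (\prod_(j < size P) `|denq P`_j|)%N.
  by rewrite prodn_gt0 // => j; rewrite absz_gt0 denq_neq0.
move=> p D p_pr pn; have KN := Qp_completion D.
have rE : map_poly (Qp_incl D) (map_poly ratr P) = map_poly (Qsep_emb D) (map_poly ratr P).
  by rewrite -!map_poly_comp; apply: eq_map_poly => c /=; rewrite !fmorph_rat.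
have r0 : ratr 0 = 0 :> Qp D by exact: (ratr_int (Qp D) 0).
have r1 : ratr 1 = 1 :> Qp D by exact: (ratr_int (Qp D) 1).
exists (map_poly ratr P); split.
- by rewrite monicE lead_coef_map_id0 // (eqP Pm) r1 ?oner_neq0.
- move=> j; rewrite coef_map_id0 //.
  rewrite (padic_ratr KN) /padic_norm; case: eqP => [_ //|_].
  have [jP|Pj] := ltnP j (size P); last first.
    by rewrite nth_default // logn1 expr0 logn0 expr0 divr1.
  have -> : logn p `|denq P`_j| = 0%N.
    rewrite lognE p_pr absz_gt0 denq_neq0 /=; case: ifP => // pd.
    by case/negP: pn; rewrite (bigD1 (Ordinal jP)) //= dvdn_mulr.
  rewrite expr0 div1r invf_le1 ?exprn_gt0 ?ltr0n ?prime_gt0 //.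
  by rewrite exprn_ege1 // ler1n prime_gt0.
- by rewrite rE fmorph_root -PE root_minCpoly.
Qed.

(* For almost all p the inverses of the nonzero differences z - y, z conjugate
   to y, are p-integral, so that s y - y cannot be a nonzero non-unit. *)
Lemma almost_unramified (y : algC) : exists2 n : nat, (0 < n)%N &
  forall p (D : local_closure p) s, prime p -> ~~ (p %| n)%N -> inertia s ->
  @ip_star p D s y = y.
Proof.
have [P [PE Pm] _] := minCpolyP y.
have [r rE] := closed_field_poly_normal (map_poly ratr P : {poly algC}).
have rP z : root (map_poly ratr P) z = (z \in r).
  by rewrite rE rootZ ?lead_coef_eq0 ?map_poly_eq0 ?monic_neq0 // root_prod_XsubC.
have [n n0 nE] : exists2 n : nat, (0 < n)%N &
    forall p (D : local_closure p), prime p -> ~~ (p %| n)%N ->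
    forall z, z \in r -> local_int (Qsep_emb D (z - y)^-1).
  elim: r {rE rP} => [|z r [n n0 nE]]; first by exists 1%N.
  have [m m0 mE] := almost_integral (z - y)^-1.
  exists (n * m)%N; first by rewrite muln_gt0 n0.
  move=> p D p_pr; rewrite Euclid_dvdM // negb_or => /andP[pn pm] x.
  by rewrite inE => /predU1P[->|xr]; [exact: mE | exact: nE].
have [m m0 mE] := almost_integral y.
exists (n * m)%N; first by rewrite muln_gt0 n0.
move=> p D s p_pr; rewrite Euclid_dvdM // negb_or => /andP[pn pm] [sK sI].
pose z := ip_star s y.
have zr : z \in r.
  rewrite -rP (@eq_map_poly _ _ ratr (ip_star s \o ratr)) => [|c].
    by rewrite map_poly_comp fmorph_root -PE root_minCpoly.
  by rewrite /= fmorph_rat.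
apply: contrapT => /eqP zy; have [_] := sI _ (mE p D p_pr pm); apply.
exists (Qsep_emb D (z - y)^-1); first exact: nE.
by rewrite -ip_starE -rmorphB -rmorphM mulfV ?rmorph1 // subr_eq0.
Qed.

Section SigmaValues.
Variables (p : nat) (D : local_closure p).
Hypotheses (p_pr : prime p) (p_odd : odd p).

Lemma chi_inertia2_unramified (a : int) (s : GQpro2) :
  ~~ (p %| `|a|)%N -> inertia2 D s -> chi a s = 0.
Proof.
move=> pa [_ [u uI <-] <-].
have a0 : a != 0 by apply: contraNneq pa => ->; rewrite dvdn0.
rewrite chi_res //; apply: (chi_unique algC_pchar0 a0 (sqrtCK _)).
rewrite sgF0 mul1r; apply: (fmorph_inj (Qsep_emb D)); rewrite ip_starE.
apply: (inertia_unramified p_pr p_odd pa _ uI).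
by rewrite -rmorphXn sqrtCK rmorph_int.
Qed.

Lemma chi_inertia2_ramified (a : int) : logn p `|a| = 1%N ->
  exists2 s : GQpro2, inertia2 D s & chi a s = 1.
Proof.
move=> la; have a0 : a != 0 by apply: contra_eq_neq la => ->; rewrite logn0.
have wa : Qsep_emb D (sqrtC a%:~R) ^+ 2 = a%:~R.
  by rewrite -rmorphXn sqrtCK rmorph_int.
have [s sI sw] := inertia_ramified p_pr p_odd la wa.
exists (res_pro2 (ip_star s)); first by exists (ip_star s) => //; exists s.
rewrite chi_res //; apply: (chi_unique algC_pchar0 a0 (sqrtCK _)).
by rewrite sgF1 mulN1r; apply: (fmorph_inj (Qsep_emb D)); rewrite ip_starE sw rmorphN.
Qed.

Lemma topological_generator_mem (s : GQpro2) :
  topological_generator (inertia2 D) s -> inertia2 D s.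
Proof.
by move=> <-; apply: subset_closure; exists 1%N; left; rewrite expg1.
Qed.

Lemma chi_topological_generator (a : int) (s : GQpro2) :
  topological_generator (inertia2 D) s -> logn p `|a| = 1%N -> chi a s = 1.
Proof.
move=> sgen la; have a0 : a != 0 by apply: contra_eq_neq la => ->; rewrite logn0.
have [t] := chi_inertia2_ramified la; rewrite -sgen => /closure_autP tcl ct.
have [w wE] := chi_agree a0; have [u uE tu] := tcl [:: w].
have cu : chi a u = 1 by rewrite -ct; apply: wE; apply: tu; rewrite inE.
have chi1' : chi a (1%g : GQpro2) = 0.
  by have := chiM 1%g 1%g a0; rewrite mulg1 addF2K.
apply: F2_neq0; apply: contra_eq_neq cu => cs.
have sn n : chi a (s ^+ n)%g = 0.
  by elim: n => [|n IHn]; rewrite ?expg0 // expgS chiM // cs IHn addr0.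
case: uE => n [] ->; first by rewrite sn eq_sym oner_eq0.
have := chiM (s ^+ n)%g (s ^- n)%g a0; rewrite mulgV chi1' sn add0r => <-.
by rewrite eq_sym oner_eq0.
Qed.

End SigmaValues.

Lemma squarefree_neq0 (a : int) : squarefree a -> a != 0.
Proof. by move=> sa; apply/eqP => a0; have := sa 0%N; rewrite a0 => /(_ isT). Qed.

Lemma squarefree_unit (a : int) : `|a|%N = 1%N -> squarefree a.
Proof. by move=> a1 d; rewrite a1 dvdn1 -[1%N](exp1n 2) eqn_sqr => /eqP. Qed.

Lemma squarefree_logn (a : int) : squarefree a <->
  a != 0 /\ forall p, prime p -> (logn p `|a| <= 1)%N.
Proof.
split=> [sa|[a0 la] d da].
  have a0 := squarefree_neq0 sa; split=> // p p_pr; rewrite leqNgt; apply/negP => la.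
  have /sa p1 : (p ^ 2 %| `|a|)%N by rewrite pfactor_dvdn // absz_gt0.
  by rewrite p1 in p_pr.
have aN0 : (0 < `|a|)%N by rewrite absz_gt0.
have d0 : (0 < d)%N by case: d da => //; rewrite exp0n // dvd0n -leqn0 leqNgt aN0.
apply/eqP; rewrite eqn_leq d0 andbT leqNgt; apply/negP => d1.
have pp := pdiv_prime d1; have := la _ pp; rewrite leqNgt => /negP; apply.
by rewrite -pfactor_dvdn // (dvdn_trans _ da) // dvdn_exp2r // pdiv_dvd.
Qed.

Lemma squarefree_dvd_logn (a : int) p : squarefree a -> prime p ->
  logn p `|a| = (p %| `|a|)%N.
Proof.
move=> sa p_pr; have [a0 la] := (squarefree_logn a).1 sa.
have := la p p_pr; have := pfactor_dvdn 1 p_pr (_ : (0 < `|a|)%N).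
by rewrite absz_gt0 expn1 => -> //; case: (logn p `|a|) => [|[|]].
Qed.

Lemma squarefree_eq (a b : int) : squarefree a -> squarefree b ->
  (forall p, prime p -> (p %| `|a|)%N = (p %| `|b|)%N) -> (a < 0) = (b < 0) -> a = b.
Proof.
move=> sa sb ab sgn; have a0 := squarefree_neq0 sa; have b0 := squarefree_neq0 sb.
have E : `|a|%N = `|b|%N.
  apply/eqn_from_log; rewrite ?absz_gt0 // => p.
  have [p_pr|np] := boolP (prime p); first by rewrite !squarefree_dvd_logn // ab.
  by rewrite lognE (negbTE np) /= lognE (negbTE np).
by rewrite [a]intEsign [b]intEsign E sgn.
Qed.

Lemma squarefree_part (a : int) : a != 0 -> exists2 b : int, squarefree b &
  exists2 d : int, d != 0 & a = b * d ^+ 2.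
Proof.
have [n] := ubnP `|a|%N; elim: n => // n IHn in a *; rewrite ltnS => an a0.
have [sa|/existsNP[d /not_implyP[da d1]]] := pselect (squarefree a).
  by exists a => //; exists 1; rewrite ?expr1n ?mulr1.
have d0 : (0 < d)%N.
  by case: d da {d1} => //; rewrite exp0n // dvd0n absz_eq0 (negbTE a0).
have /dvdzP[c cE] : (d%:Z ^+ 2 %| a)%Z by rewrite dvdzE abszX.
have c0 : c != 0 by apply: contra_neq a0 => c0; rewrite cE c0 mul0r.
have [||b sb [e e0 ce]] := IHn c.
- rewrite (leq_trans _ an) // cE abszM abszX /= ltn_Pmulr ?absz_gt0 //.
  by rewrite -{1}(exp1n 2) ltn_exp2r // ltn_neqAle d0 andbT eq_sym; apply/eqP.
- exact: c0.
exists b => //; exists (e * d%:Z); first by rewrite mulf_neq0 // -lt0n.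
by rewrite cE ce exprMn [RHS]mulrA.
Qed.

Lemma chi_prod (I : Type) (r : seq I) (P : pred I) (F : I -> int) (s : GQpro2) :
  (forall i, P i -> F i != 0) ->
  chi (\prod_(i <- r | P i) F i) s = \sum_(i <- r | P i) chi (F i) s.
Proof.
move=> F0; elim: r => [|i r IHr]; first by rewrite !big_nil chi1.
rewrite !big_cons; case: ifP => // Pi; rewrite chi_mul ?F0 ?IHr //.
by elim/big_rec: _ => // j x Pj x0; rewrite mulf_neq0 ?F0.
Qed.

Section SigmaSystem.
Variables (loc : forall p : nat, prime p -> local_closure p)
  (sigma : nat -> GQpro2) (sigma21 sigma22 : GQpro2).
Hypothesis sys : is_Sigma_system loc sigma sigma21 sigma22.

Notation Sigma := (Sigma_set sigma sigma21 sigma22).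

Lemma Sigma_odd p : prime p -> odd p -> Sigma (sigma p).
Proof. by move=> p_pr p_odd; left; exists p. Qed.

Lemma Sigma21 : Sigma sigma21. Proof. by right; left. Qed.

Lemma Sigma22 : Sigma sigma22. Proof. by right; right. Qed.

Lemma sigma_inertia p (p_pr : prime p) : odd p -> inertia2 (loc p_pr) (sigma p).
Proof.
move=> p_odd; have [gen _ _ _] := sys.
exact: topological_generator_mem (gen p p_pr p_odd).
Qed.

Lemma chi_sigma (a : int) p : squarefree a -> prime p -> odd p ->
  chi a (sigma p) = (p %| `|a|)%N%:R.
Proof.
move=> sa p_pr p_odd; have [gen _ _ _] := sys.
have [pa|pa] := boolP (p %| `|a|)%N; last first.
  exact: (chi_inertia2_unramified p_pr p_odd pa (sigma_inertia p_pr p_odd)).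
apply: (chi_topological_generator p_pr p_odd (gen p p_pr p_odd)).
by rewrite squarefree_dvd_logn // pa.
Qed.

Lemma squarefree_prime p : prime p -> squarefree p%:Z.
Proof.
move=> p_pr; apply/squarefree_logn; split; first by rewrite -lt0n prime_gt0.
by move=> q q_pr; rewrite logn_prime //; case: eqP.
Qed.

Lemma odd_prime_ndvd2 p : prime p -> odd p -> (p %| 2)%N = false.
Proof.
by move=> p_pr p_odd; rewrite dvdn_prime2 //; apply: contraTF p_odd => /eqP ->.
Qed.

Lemma chi_N1_sigma p : prime p -> odd p -> chi (-1) (sigma p) = 0.
Proof.
move=> p_pr p_odd; rewrite (chi_sigma (squarefree_unit abszN1)) // abszN1 dvdn1.
by case: eqP p_pr => // ->.
Qed.

Lemma chi_2_sigma p : prime p -> odd p -> chi 2 (sigma p) = 0.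
Proof.
by move=> p_pr p_odd; rewrite (chi_sigma (@squarefree_prime 2 isT)) // odd_prime_ndvd2.
Qed.

Definition sgn2 (x e : bool) : int := (-1) ^+ x * 2 ^+ e.

Lemma sgn2_neq0 x e : sgn2 x e != 0. Proof. by case: x; case: e. Qed.

Lemma chi_sgn2 x e (s : GQpro2) :
  chi (sgn2 x e) s = x%:R * chi (-1) s + e%:R * chi 2 s.
Proof.
rewrite chi_mul ?expf_neq0 //; congr (_ + _).
  by case: x; rewrite ?expr1 ?expr0 ?chi1 ?mul1r ?mul0r.
by case: e; rewrite ?expr1 ?expr0 ?chi1 ?mul1r ?mul0r.
Qed.

Lemma chi_sgn2_21 x e : chi (sgn2 x e) sigma21 = e%:R.
Proof. by have [_ _ [c2 _] [c1 _]] := sys; rewrite chi_sgn2 c1 c2 mulr0 add0r mulr1. Qed.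

Lemma chi_sgn2_22 x e : chi (sgn2 x e) sigma22 = x%:R.
Proof. by have [_ _ [_ c2] [_ c1]] := sys; rewrite chi_sgn2 c1 c2 mulr0 addr0 mulr1. Qed.

Lemma chi_sgn2_odd x e p : prime p -> odd p -> chi (sgn2 x e) (sigma p) = 0.
Proof. by move=> *; rewrite chi_sgn2 chi_N1_sigma // chi_2_sigma // !mulr0 addr0. Qed.

Lemma squarefree_decomp (a : int) : squarefree a ->
  a = sgn2 (a < 0)%R (2 %| `|a|)%N * ((absz a)`_2^')%N.
Proof.
move=> sa; have a0 := squarefree_neq0 sa.
rewrite {1}[a]intEsign /sgn2 -mulrA; congr (_ * _).
rewrite -{1}[`|a|%N](partnC 2%N) ?absz_gt0 // p_part squarefree_dvd_logn //.
by rewrite PoszM; congr (_ * _); case: (2 %| _)%N.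
Qed.

Lemma F2_natr_inj (x y : bool) : x%:R = y%:R :> 'F_2 -> x = y.
Proof. by case: x; case: y. Qed.

Lemma squarefree_chi_inj (a b : int) : squarefree a -> squarefree b ->
  (forall s, Sigma s -> chi a s = chi b s) -> a = b.
Proof.
move=> sa sb ab; have a0 := squarefree_neq0 sa; have b0 := squarefree_neq0 sb.
have ab_odd p : prime p -> odd p -> (p %| `|a|)%N = (p %| `|b|)%N.
  move=> p_pr p_odd; apply: F2_natr_inj.
  by rewrite -!chi_sigma // ab //; exact: Sigma_odd.
have odd_part : ((absz a)`_2^' = (absz b)`_2^')%N.
  have lg x p : (0 < x)%N -> prime p -> odd p -> logn p (x`_2^')%N = logn p x.
    move=> x0 p_pr p_odd; have p2 : (p == 2)%N = false.
      by apply: contraTF p_odd => /eqP ->.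
    rewrite -{2}(partnC 2%N x0) lognM ?part_gt0 // p_part lognX.
    by rewrite (logn_prime p (isT : prime 2)) p2 muln0.
  have lg2 x : logn 2 (x`_2^')%N = 0%N.
    have n2 : ~~ (2 %| x`_2^')%N by rewrite -p'natE // part_pnat.
    by rewrite lognE (negbTE n2) !andbF.
  apply/eqn_from_log; rewrite ?part_gt0 // => p.
  have [p_pr|np] := boolP (prime p); last first.
    by rewrite lognE (negbTE np) /= lognE (negbTE np).
  have [->|p_odd] := even_prime p_pr; first by rewrite !lg2.
  by rewrite !lg ?absz_gt0 // !squarefree_dvd_logn // ab_odd.
have m0 : ((absz b)`_2^')%N%:Z != 0 by rewrite -lt0n part_gt0.
set ua := sgn2 (a < 0)%R (2 %| `|a|)%N.
set ub := sgn2 (b < 0)%R (2 %| `|b|)%N.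
have uE s : Sigma s -> chi ua s = chi ub s.
  move=> /ab; rewrite {1}(squarefree_decomp sa) {1}(squarefree_decomp sb) odd_part.
  by rewrite !(chi_mul _ (sgn2_neq0 _ _) m0) => /addIr.
have E2 : (2 %| `|a|)%N = (2 %| `|b|)%N.
  by apply: F2_natr_inj; have := uE _ Sigma21; rewrite !chi_sgn2_21.
apply: squarefree_eq => // [p p_pr|].
  by have [->//|] := even_prime p_pr; exact: ab_odd.
by apply: F2_natr_inj; have := uE _ Sigma22; rewrite !chi_sgn2_22.
Qed.

Lemma chi_prescribe (e : nat -> 'F_2) (e1 e2 : 'F_2) (B : nat) :
  (forall p, (B <= p)%N -> e p = 0) ->
  exists2 a : int, a != 0 & [/\ forall p, prime p -> odd p -> chi a (sigma p) = e p,
    chi a sigma21 = e1 & chi a sigma22 = e2].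
Proof.
move=> eB; pose P p := [&& prime p, odd p & e p != 0].
pose m : int := \prod_(0 <= p < B | P p) p%:Z.
have m0 : m != 0.
  rewrite /m; elim/big_rec: _ => // p x /and3P[p_pr _ _] x0.
  by rewrite mulf_neq0 // -lt0n prime_gt0.
have mE p : prime p -> odd p -> chi m (sigma p) = e p.
  move=> p_pr p_odd; rewrite chi_prod; last first.
    by move=> q /and3P[q_pr _ _]; rewrite -lt0n prime_gt0.
  have term q : P q -> chi q%:Z (sigma p) = (p == q)%:R.
    move=> /and3P[q_pr _ _]; rewrite chi_sigma //; last exact: squarefree_prime.
    by rewrite dvdn_prime2.
  rewrite (eq_bigr _ term).
  have [ep|ep] := eqVneq (e p) 0.
    rewrite big1_seq // => q /andP[/and3P[_ _ eq0] _].
    by case: eqP => // pq; rewrite -pq ep eqxx in eq0.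
  have pB : (p < B)%N by rewrite ltnNge; apply: contra_neqN ep => /eB.
  rewrite big_mkcond (bigD1_seq p) ?iota_uniq ?mem_index_iota //=.
  rewrite {1}/P p_pr p_odd ep eqxx big1 ?addr0 => [|q qp]; first exact/esym/F2_neq0.
  by rewrite eq_sym (negbTE qp) if_same.
pose y := e1 - chi m sigma21; pose x := e2 - chi m sigma22.
exists (sgn2 (x != 0) (y != 0) * m); first by rewrite mulf_neq0 ?sgn2_neq0.
have b2 (c : 'F_2) : (c != 0)%:R = c by case: (F2P c) => ->.
split=> [p p_pr p_odd||]; rewrite (chi_mul _ (sgn2_neq0 _ _) m0).
- by rewrite chi_sgn2_odd // add0r mE.
- by rewrite chi_sgn2_21 b2 subrK.
- by rewrite chi_sgn2_22 b2 subrK.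
Qed.

Lemma sigma_almost_fix (y : Qpro2) : exists B, forall p, (B <= p)%N -> prime p -> odd p ->
  sigma p y = y.
Proof.
have [n n0 nE] := almost_unramified (Qpro2_incl y); exists n.+1 => p np p_pr p_odd.
have pn : ~~ (p %| n)%N by apply/negP => /(dvdn_leq n0); rewrite leqNgt np.
have [_ [u uI <-] <-] := sigma_inertia p_pr p_odd.
by apply: (fmorph_inj Qpro2_incl); rewrite res_pro2E (nE _ _ _ p_pr pn uI).
Qed.

End SigmaSystem.

(** * The groups G_n *)

Local Notation coord := Defs.coord.

Section Carrier.
Variables (theta : cochains) (r : nat).
Hypothesis adm : admissible theta r.

Notation mul := (gmul theta).

Lemma gmul_cancelr n (g h k : carrier n) : mul g k = mul h k -> g = h.
Proof.
elim: n g h k => [|n IHn]; first by case; case.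
move=> [a g] [b h] [c k] /= E; have gh := IHn _ _ _ (congr1 snd E).
by have := congr1 fst E; rewrite /= gh => /addIr/addIr ->.
Qed.

Lemma gmul_id n : (n <= r)%N ->
  forall g : carrier n, mul (gid n) g = g /\ mul g (gid n) = g.
Proof.
elim: n => [|n IHn] nr; first by case.
have {}IHn := IHn (ltnW nr); have [cc c1 _] := adm nr.
have l1 k : theta (gid n) k = 0.
  have := cc (gid n) (gid n) k; rewrite !(IHn _).1 c1 subr0 subrr add0r; exact.
have r1 k : theta k (gid n) = 0.
  have := cc k (gid n) (gid n); rewrite !(IHn _).2 c1 sub0r addNr sub0r.
  by move=> /eqP; rewrite oppr_eq0 => /eqP.
by case=> a g; rewrite /= l1 r1 (IHn g).1 (IHn g).2 !addr0 add0r.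
Qed.

Lemma gmul1l n (g : carrier n) : (n <= r)%N -> mul (gid n) g = g.
Proof. by move=> nr; have [] := gmul_id nr g. Qed.

Lemma gmul1r n (g : carrier n) : (n <= r)%N -> mul g (gid n) = g.
Proof. by move=> nr; have [] := gmul_id nr g. Qed.

Lemma theta1l n (g : carrier n) : (n < r)%N -> theta (gid n) g = 0.
Proof. by move=> nr; have := congr1 fst (@gmul1l n.+1 (0, g) nr); rewrite /= !add0r. Qed.

Section Homomorphism.
Variables (L : fieldType) (n : nat) (rho : aut L -> carrier n).
Hypothesis (nr : (n <= r)%N) (rhoM : forall s t, rho (s * t)%g = mul (rho s) (rho t)).

Lemma ghom1 : rho 1%g = gid n.
Proof. by apply: (@gmul_cancelr _ _ _ (rho 1%g)); rewrite -rhoM mulg1 gmul1l. Qed.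

Lemma ghom_eq s t : rho s = rho t <-> rho (s * t^-1)%g = gid n.
Proof.
split=> E; last by rewrite -[s](mulgKV t) rhoM E gmul1l.
by apply: (@gmul_cancelr _ _ _ (rho t)); rewrite -rhoM mulgKV gmul1l.
Qed.

Lemma ghom_ker_conj s t : rho s = gid n -> rho (t^-1 * s * t)%g = gid n.
Proof. by move=> E; rewrite !rhoM E gmul1r // -rhoM mulVg ghom1. Qed.

End Homomorphism.

Lemma ghom_snd (L : fieldType) n (rho : aut L -> carrier n.+1) :
  (forall s t, rho (s * t)%g = mul (rho s) (rho t)) ->
  forall s t, (rho (s * t)%g).2 = mul (rho s).2 (rho t).2.
Proof. by move=> rhoM s t; rewrite rhoM. Qed.

Lemma ghom_exp (L : fieldType) n (rho : aut L -> carrier n) : (n <= r)%N ->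
  (forall s t, rho (s * t)%g = mul (rho s) (rho t)) ->
  forall s, rho (s ^+ (2 ^ n))%g = gid n.
Proof.
elim: n rho => [|n IHn] rho nr rhoM s; first by case: (rho _).
rewrite expnSr expgM; set t := (s ^+ _)%g.
have t1 : (rho t).2 = gid n := IHn _ (ltnW nr) (ghom_snd rhoM) s.
rewrite expgS expg1 rhoM; case: (rho t) t1 => a g /= ->.
by rewrite addF2K add0r theta1l // gmul1l // ltnW.
Qed.

Lemma surj_or_factor (L : fieldType) n (rho : aut L -> carrier n.+1) : (n < r)%N ->
  (forall s t, rho (s * t)%g = mul (rho s) (rho t)) ->
  (forall g, exists s, (rho s).2 = g) ->
  (forall g, exists s, rho s = g) \/
  exists f : carrier n -> 'F_2, (forall s, (rho s).1 = f (rho s).2) /\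
    forall g h, theta g h = coboundary (@gmul theta n) f g h.
Proof.
move=> nr rhoM rho2.
have [[u u1]|nu] := pselect (exists u, rho u = (1, gid n)).
  left=> -[a g]; have [s sg] := rho2 g.
  have [->|] := eqVneq a (rho s).1; first by exists s; rewrite -sg; case: (rho s).
  move=> E; exists (u * s)%g; rewrite rhoM u1 /= sg theta1l // gmul1l ?addr0 1?ltnW //.
  congr (_, _); move: E; case: (F2P a) => ->; case: (F2P (rho s).1) => ->.
  - by rewrite eqxx.
  - by rewrite addF2K.
  - by rewrite addr0.
  - by rewrite eqxx.
right.
have ker s : (rho s).2 = gid n -> (rho s).1 = 0.
  move=> s2; apply: contrapT => /eqP/F2_neq0 s1; apply: nu; exists s.
  by rewrite -s1 -s2; case: (rho s).
have eq12 s t : (rho s).2 = (rho t).2 -> (rho s).1 = (rho t).1.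
  move=> /(ghom_eq (ltnW nr) (ghom_snd rhoM)) st.
  by rewrite -[s](mulgKV t) rhoM /= (ker _ st) st theta1l // add0r addr0.
have [sec secE] := choice rho2; exists (fun g => (rho (sec g)).1).
have fE s : (rho s).1 = (rho (sec (rho s).2)).1 by apply: eq12; rewrite secE.
split=> // g h; rewrite /coboundary -{1 2}[g]secE -{1 2}[h]secE -(ghom_snd rhoM) -fE.
by rewrite rhoM /=; ring.
Qed.

Lemma ghom_F2_span n (f : carrier n -> 'F_2) : (n <= r)%N ->
  (forall g h, f (mul g h) = f g + f h) ->
  exists c : nat -> 'F_2, forall g,
    f g = \sum_(j < n | `[< cochain0 theta j >]) c j * coord g j.
Proof.
elim: n f => [|n IHn] f nr fM.
  exists (fun _ => 0) => g; rewrite big_ord0.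
  by apply: (addrI (f g)); rewrite addr0 -fM; congr f; case: (gmul _ _ _); case: g.
have f_split a g : f (a, g) = a * f (1, gid n) + f (0, g).
  have -> : (a, g) = mul ((a, gid n) : carrier n.+1) ((0, g) : carrier n.+1).
    by rewrite /= theta1l // !addr0 gmul1l // ltnW.
  rewrite fM; congr (_ + _); case: (F2P a) => ->; last by rewrite mul1r.
  by rewrite mul0r; apply: (addrI (f (gid n.+1))); rewrite addr0 -fM gmul1l.
have f0 g h : f (0, g) + f (0, h) = theta g h * f (1, gid n) + f (0, mul g h).
  by rewrite -fM -f_split /= !add0r.
have [c1|nc] := pselect (cochain0 theta n).
  have [|c cE] := IHn (fun g => f (0, g)) (ltnW nr).
    by move=> g h; rewrite f0 c1 mul0r add0r.
  exists (fun j => if j == n then f (1, gid n) else c j) => -[a g].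
  rewrite big_mkcond big_ord_recr /= eqxx asboolT // f_split mulrC addrC; congr (_ + _).
  rewrite cE big_mkcond; apply: eq_bigr => j _ /=.
  by rewrite ltn_eqF // ltn_ord.
have f1 : f (1, gid n) = 0.
  apply: contrapT => /eqP/F2_neq0 f1; have [_ _ [H _]] := adm nr.
  apply: nc; apply: H; exists (fun g => f (0, g)) => g h.
  have := f0 g h; rewrite f1 mulr1 /coboundary -addrA -opprD => ->.
  by rewrite opprD addrCA subrr addr0 oppF2.
have [|c cE] := IHn (fun g => f (0, g)) (ltnW nr).
  by move=> g h; rewrite f0 f1 mulr0 add0r.
exists c => -[a g]; rewrite big_mkcond big_ord_recr /= asboolF // addr0.
rewrite f_split f1 mulr0 add0r cE big_mkcond; apply: eq_bigr => j _ /=.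
by rewrite ltn_eqF // ltn_ord.
Qed.

Lemma coord_gid n j : coord (gid n) j = 0.
Proof. by elim: n => //= n ->; case: ifP. Qed.

End Carrier.

Lemma carrier_ext n (g h : carrier n) :
  (forall j, (j < n)%N -> coord g j = coord h j) -> g = h.
Proof.
elim: n g h => [|n IHn] /= g h; first by case: g; case: h.
case: g h => a g [b h] gh; congr (_, _); first by have := gh n (ltnSn n); rewrite eqxx.
by apply: IHn => j jn; have := gh j (ltnW jn); rewrite ltn_eqF.
Qed.

Fixpoint of_coord (n : nat) (b : nat -> 'F_2) : carrier n :=
  if n is m.+1 return carrier n then (b m, of_coord m b) else tt.

Lemma coord_of_coord n b j : (j < n)%N -> coord (of_coord n b) j = b j.
Proof.
elim: n => //= n IHn; rewrite ltnS leq_eqVlt; case: eqP => [-> //|_ /=].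
exact: IHn.
Qed.

(** * The bijection Pow *)

Section Pow.
Variable r : nat.

Notation I := (nontriv r).
Implicit Types (v : {ffun I -> int}) (g h : I).

Lemma nontriv_coord g : exists2 j, (j < r)%N & coord (val g) j = 1.
Proof.
apply: contrapT => ng; have /eqP := valP g; apply; apply: carrier_ext => j jr.
rewrite coord_gid; apply: contrapT => /eqP/F2_neq0 gj; apply: ng; by exists j.
Qed.

Lemma prime_dvd_Pow v j p : prime p ->
  (p %| `|Pow v j|)%N <-> exists2 g, coord (val g) j = 1 & (p %| `|v g|)%N.
Proof.
move=> p_pr; rewrite /Pow (big_morph absz abszM (erefl : `|1%Z|%N = 1%N)).
rewrite Euclid_dvd_prod // big_orE; split.
  by move=> /existsP[g /andP[/eqP gj pg]]; exists g.
by move=> [g gj pg]; apply/existsP; exists g; rewrite gj eqxx.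
Qed.

Lemma Prim_neq0 v g : Prim v -> v g != 0.
Proof. by move=> [vs _]; exact: squarefree_neq0. Qed.

Lemma Prim_prime_uniq v g h p : Prim v -> prime p ->
  (p %| `|v g|)%N -> (p %| `|v h|)%N -> g = h.
Proof.
move=> [_ vc] p_pr pg ph; apply/eqP; apply: contraT => gh.
have [/eqP cop _] := vc _ _ gh.
have : (p %| gcdn `|v g| `|v h|)%N by rewrite dvdn_gcd pg.
by move: cop; rewrite /gcdz => -[->]; rewrite dvdn1; case: eqP p_pr => // ->.
Qed.

Lemma Prim_neg_uniq v g h : Prim v -> v g < 0 -> v h < 0 -> g = h.
Proof.
move=> [_ vc] vg vh; apply/eqP; apply: contraT => gh.
by have [_] := vc _ _ gh; case.
Qed.

Lemma neg_Pow v j : Prim v -> (Pow v j < 0) <-> exists2 g, coord (val g) j = 1 & v g < 0.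
Proof.
move=> vP; have v0 g := Prim_neq0 g vP; split=> [|[g gj vg]].
  move=> Pj; apply: contrapT => ng; move: Pj; rewrite ltNge => /negP; apply.
  apply: prodr_ge0 => g /eqP gj; rewrite leNgt; apply/negP => vg; apply: ng.
  by exists g.
rewrite /Pow (bigD1 g) ?gj //= pmulr_llt0 //.
apply: prodr_gt0 => h /andP[_ hg]; rewrite lt0r v0 leNgt /=.
by apply: contraNN hg => vh; apply/eqP/(Prim_neg_uniq vP).
Qed.

Lemma squarefree_Pow v j : Prim v -> squarefree (Pow v j).
Proof.
move=> vP; have v0 g := Prim_neq0 g vP; apply/squarefree_logn; split.
  by apply/prodf_neq0.
move=> p p_pr.
have [pP|pP] := boolP (p %| `|Pow v j|)%N; last first.
  by rewrite lognE (negbTE pP) !andbF.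
have [g gj pg] := (prime_dvd_Pow v j p_pr).1 pP.
rewrite /Pow (bigD1 g) ?gj //= abszM lognM ?absz_gt0 //; last by apply/prodf_neq0.
rewrite squarefree_dvd_logn ?pg //; last exact: vP.1.
rewrite [X in (_ + X)%N](_ : _ = 0%N) ?addn0 //.
have : ~~ (p %| `|(\prod_(h | (coord (val h) j == 1) && (h != g)) v h)%R|)%N.
  elim/big_rec: _ => [|h x /andP[_ hg] px].
    by rewrite dvdn1; case: eqP p_pr => // ->.
  rewrite abszM Euclid_dvdM // negb_or px andbT; apply: contraNN hg => ph.
  exact/eqP/(Prim_prime_uniq vP p_pr).
by move=> /negbTE pn; rewrite lognE pn !andbF.
Qed.

Lemma Pow_inj v w : Prim v -> Prim w ->
  (forall j, (j < r)%N -> Pow v j = Pow w j) -> v = w.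
Proof.
move=> vP wP vw; apply/ffunP => g.
(* Q is divisibility by a prime, or negativity. *)
have key (Q : int -> bool) :
    (forall u : {ffun I -> int}, Prim u -> forall g h, Q (u g) -> Q (u h) -> g = h) ->
    (forall u : {ffun I -> int}, Prim u ->
      forall j, Q (Pow u j) <-> exists2 g : I, coord (val g) j = 1 & Q (u g)) ->
    forall u u' : {ffun I -> int}, Prim u -> Prim u' ->
    (forall j, (j < r)%N -> Pow u j = Pow u' j) -> Q (u g) -> Q (u' g).
  move=> Q1 QP u u' uP u'P uu' Qg.
  have coordE (x : {ffun I -> int}) : Prim x -> forall h, Q (x h) ->
      forall j, coord (val h) j = 1 <-> Q (Pow x j).
    move=> xP h Qh j; rewrite (QP _ xP); split=> [hj|[k kj Qk]]; first by exists h.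
    by rewrite (Q1 _ xP _ _ Qh Qk).
  have [j0 j0r gj0] := nontriv_coord g.
  have /(QP _ u'P)[h _ Qh] : Q (Pow u' j0).
    by rewrite -uu' //; apply: (coordE _ uP _ Qg _).1.
  suff gh : g = h by rewrite gh.
  apply/val_inj/carrier_ext => j jr; have := uu' j jr => uj.
  have gE := coordE _ uP _ Qg j; have hE := coordE _ u'P _ Qh j; rewrite -uj in hE.
  have [gj|gj] := F2P (coord (val g) j); have [hj|hj] := F2P (coord (val h) j);
    rewrite gj hj //.
    by have := gE.2 (hE.1 hj); rewrite gj.
  by have := hE.2 (gE.1 gj); rewrite hj.
have wv j : (j < r)%N -> Pow w j = Pow v j by move=> jr; rewrite vw.
apply: squarefree_eq; [exact: vP.1|exact: wP.1| |].
  move=> p p_pr; have dvdK := key (fun a => (p %| `|a|)%N)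
    (fun u uP g h => Prim_prime_uniq uP p_pr) (fun u _ j => prime_dvd_Pow u j p_pr).
  by apply/idP/idP; apply: dvdK.
have negK := key (fun a => a < 0) (fun u uP g h => @Prim_neg_uniq u g h uP)
  (fun u uP j => neg_Pow j uP).
by apply/idP/idP; apply: negK.
Qed.

Lemma Pow_surj (w : nat -> int) : (forall j, squarefree (w j)) ->
  exists2 v : {ffun I -> int}, Prim v & forall j, (j < r)%N -> Pow v j = w j.
Proof.
move=> ws; have w0 j := squarefree_neq0 (ws j).
pose pat p : carrier r := of_coord r (fun j => (p %| `|w j|)%N%:R).
pose pat0 : carrier r := of_coord r (fun j => (w j < 0)%R%:R).
have /choice[ix ixP] g : exists j, (j < r)%N /\ coord (val (g : I)) j = 1.
  by have [j jr gj] := nontriv_coord g; exists j.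
(* The primes p with pattern g all divide w (ix g), so their product can be taken
   as a part of w (ix g), which is squarefree because w (ix g) is. *)
pose n (g : I) := partn (absz (w (ix g))) [pred p | pat p == val g].
pose v : {ffun I -> int} := [ffun g => (-1) ^+ (pat0 == val g) * (n g)%:Z].
have n0 g : (0 < n g)%N by exact: part_gt0.
have vn g : `|v g|%N = n g by rewrite ffunE abszMsign.
have vneg g : (v g < 0) = (pat0 == val g).
  rewrite ffunE; case: eqP => _; rewrite ?expr1 ?expr0 ?mulN1r ?mul1r.
    by rewrite oppr_lt0 ltz_nat n0.
  by rewrite ltz_nat.
have b1 (b : bool) : (b%:R = 1 :> 'F_2) <-> b by case: b.
have vdvd p g : prime p -> (p %| `|v g|)%N = (pat p == val g).
  move=> p_pr; rewrite vn; have wg0 : (0 < `|w (ix g)|)%N by rewrite absz_gt0.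
  have := pi_of_part [pred p | pat p == val g] wg0 p.
  rewrite !inE !mem_primes p_pr wg0 n0 /= => ->.
  case: eqP => [pg|]; last by rewrite andbF.
  have [ir gc] := ixP g; move: gc.
  by rewrite (_ : val g = pat p) ?coord_of_coord // => /b1 ->.
have vS g : squarefree (v g).
  by move=> d; rewrite vn => /dvdn_trans/(_ (dvdn_part _ _)); exact: ws.
have vC g h : g != h -> coprimeS (v g) (v h).
  move=> gh; split; last first.
    rewrite !vneg => -[/eqP E /eqP E'].
    by case/eqP: gh; apply: val_inj; rewrite /= -E -E'.
  rewrite coprimezE; apply: contraT; rewrite /coprime => g1.
  have {}g1 : (1 < gcdn `|v g| `|v h|)%N.
    by rewrite ltn_neqAle eq_sym g1 gcdn_gt0 vn n0.
  have pp := pdiv_prime g1; have := pdiv_dvd (gcdn `|v g| `|v h|).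
  rewrite dvdn_gcd !vdvd // => /andP[/eqP E /eqP E'].
  by case/eqP: gh; apply: val_inj; rewrite /= -E -E'.
have vP : Prim v by [].
exists v => // j jr; apply: squarefree_eq; [exact: squarefree_Pow|exact: ws| |].
  move=> p p_pr; apply/idP/idP => [/(prime_dvd_Pow v j p_pr)[g gj]|pj].
    by rewrite vdvd // => /eqP pg; move: gj; rewrite -pg coord_of_coord // => /b1.
  apply/(prime_dvd_Pow v j p_pr).
  have patj : coord (pat p) j = 1 by rewrite coord_of_coord // pj.
  have patn : pat p != gid r.
    by apply: contra_eq_neq patj => ->; rewrite coord_gid.
  by exists (Sub (pat p) patn); rewrite ?vdvd // SubK.
apply/idP/idP => [/(neg_Pow j vP)[g gj]|wj].
  by rewrite vneg => /eqP pg; move: gj; rewrite -pg coord_of_coord // => /b1.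
apply/(neg_Pow j vP).
have patj : coord pat0 j = 1 by rewrite coord_of_coord // wj.
have patn : pat0 != gid r.
  by apply: contra_eq_neq patj => ->; rewrite coord_gid.
by exists (Sub pat0 patn); rewrite ?vneg // SubK.
Qed.

End Pow.

(** * The parametrization *)

Section Parametrization.
Variables (theta : cochains) (r : nat).
Hypothesis adm : admissible theta r.
Variables (loc : forall p : nat, prime p -> local_closure p)
  (sigma : nat -> GQpro2) (sigma21 sigma22 : GQpro2).
Hypothesis sys : is_Sigma_system loc sigma sigma21 sigma22.

Notation mul := (gmul theta).
Notation Sigma := (Sigma_set sigma sigma21 sigma22).

Lemma squarefree_character (phi : GQpro2 -> 'F_2) : kcontinuous phi ->
  (forall s t, phi (s * t)%g = phi s + phi t) ->
  exists2 b, squarefree b & forall s, phi s = chi b s.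
Proof.
move=> phic phiM; have [a a0 aE] := quadratic_character phic phiM.
have [b sb [d d0 ab]] := squarefree_part a0; exists b => // s.
by rewrite aE ab chi_mul ?(squarefree_neq0 sb) ?expf_neq0 // chi_sqr // addr0.
Qed.

Lemma trivialization_descent n (psi : GQpro2 -> carrier n) (phi : GQ -> 'F_2) :
  (n < r)%N -> Epi theta psi -> trivialization theta psi phi ->
  exists y : Qpro2, forall s t : GQ, s (Qpro2_incl y) = t (Qpro2_incl y) ->
    phi s = phi t /\ psi (res_pro2 s) = psi (res_pro2 t).
Proof.
move=> nr [psic psiM _] [/kcontinuousP phic phiE].
pose rho s : carrier n.+1 := (phi s, psi (res_pro2 s)).
have rhoM s t : rho (s * t)%g = mul (rho s) (rho t).
  rewrite /rho res_pro2M psiM /= -phiE /coboundary; congr (_, _); ring.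
have [X1 X1P] := phic 1%g; have [X2 X2P] := (kcontinuousP psi).1 psic 1%g.
have rho1 := ghom1 adm nr rhoM.
have rhoJ s t : rho s = gid n.+1 -> rho (t^-1 * s * t)%g = gid n.+1.
  exact: (ghom_ker_conj adm nr rhoM).
have rho_open : exists X, forall s, agree X 1%g s -> rho s = gid n.+1.
  exists (X1 ++ map Qpro2_incl X2) => s sX; rewrite -rho1 /rho; congr (_, _).
    by apply: X1P => x xX; apply: sX; rewrite mem_cat xX.
  rewrite res_pro2_1; apply: X2P => x xX; apply: (fmorph_inj Qpro2_incl).
  rewrite res_pro2E aut1.
  by apply: sX; rewrite mem_cat map_f ?orbT.
have rhoMul s t : rho s = gid n.+1 -> rho t = gid n.+1 -> rho (s * t)%g = gid n.+1.
  by move=> s1 t1; rewrite rhoM s1 t1 (gmul1l adm).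
have [y yP] := pro2_kernel rho1 rhoMul rhoJ rho_open (ghom_exp adm nr rhoM).
exists y => s t st.
have : rho s = rho t.
  have E : rho (t^-1 * s)%g = gid n.+1 by apply: yP; rewrite autM st autK.
  by rewrite -[s](mulKVg t) rhoM E (gmul1r adm).
by move=> E; split; [have := congr1 fst E | have := congr1 snd E].
Qed.

Lemma descent_continuous (T : choiceType) (y : Qpro2) (f : GQpro2 -> T) :
  (forall s t : GQ, s (Qpro2_incl y) = t (Qpro2_incl y) ->
    f (res_pro2 s) = f (res_pro2 t)) ->
  kcontinuous f.
Proof.
move=> fy; apply/kcontinuousP => s; exists [:: y] => t st.
have [u uE] := res_pro2_surj s; have [w wE] := res_pro2_surj t.
rewrite -uE -wE; apply: fy; rewrite -!res_pro2E uE wE st // inE //.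
Qed.

Definition cochain_lift n (psi : GQpro2 -> carrier n) (phi : GQpro2 -> 'F_2) :=
  kcontinuous phi /\
  forall s t, phi (s * t)%g = phi s + phi t + theta (psi s) (psi t).

Lemma trivialization_lift n (psi : GQpro2 -> carrier n) phi :
  (n < r)%N -> Epi theta psi ->
  trivialization theta psi (phi \o res_pro2) -> cochain_lift psi phi.
Proof.
move=> nr psiE phiT; have [y yP] := trivialization_descent nr psiE phiT.
split=> [|s t]; first by apply: (@descent_continuous _ y) => s t /yP[].
have [u <-] := res_pro2_surj s; have [w <-] := res_pro2_surj t.
have [_ /(_ u w)] := phiT; rewrite /coboundary /= res_pro2M => <-; ring.
Qed.

Lemma normalized_lift_exists n (psi : GQpro2 -> carrier n) phi :
  (n < r)%N -> Epi theta psi -> trivialization theta psi phi ->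
  exists phi' : GQpro2 -> 'F_2, trivialization theta psi (phi' \o res_pro2) /\
    forall s, Sigma s -> phi' s = 0.
Proof.
move=> nr psiE phiT; have [y yP] := trivialization_descent nr psiE phiT.
have [sec secE] := choice res_pro2_surj.
pose phi1 s := phi (sec s).
have phi1E s : phi1 (res_pro2 s) = phi s.
  by apply: (yP _ _ _).1; rewrite -!res_pro2E secE.
have [_ psiM _] := psiE; have [phic phiE] := phiT.
have phi_1 : phi 1%g = 0.
  have := phiE 1%g 1%g; rewrite /coboundary mulg1 subrr sub0r.
  have psi1 : psi (res_pro2 1%g) = gid n.
    apply: (ghom1 adm (ltnW nr) (rho := fun s => psi (res_pro2 s))) => s t.
    by rewrite res_pro2M psiM.
  by rewrite psi1 (theta1l adm) // oppF2.
have [B BP] := sigma_almost_fix sys y.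
pose e p := if [&& prime p, odd p & (p < B)%N] then phi1 (sigma p) else 0.
have eB p : (B <= p)%N -> e p = 0.
  by rewrite /e ltnNge => ->; rewrite !andbF.
have eP p : prime p -> odd p -> phi1 (sigma p) = e p.
  move=> p_pr p_odd; rewrite /e p_pr p_odd /=; case: ltnP => // Bp.
  have [u uE] := res_pro2_surj (sigma p).
  rewrite -uE phi1E -phi_1; apply: (yP _ _ _).1.
  by rewrite -res_pro2E uE BP.
have [a a0 [ap a1 a2]] := chi_prescribe sys (phi1 sigma21) (phi1 sigma22) eB.
exists (fun s => phi1 s + chi a s); split; last first.
  move=> _ [[p [p_pr p_odd ->]]|[->|->]]; rewrite ?ap ?a1 ?a2 ?addF2K //.
  by rewrite -eP // addF2K.
split.
  apply/kcontinuousP => s; have [X XP] := (kcontinuousP phi).1 phic s.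
  have [w wE] := chi_agree a0; exists (Qpro2_incl w :: X) => t st /=.
  rewrite !phi1E XP; last by move=> x xX; apply: st; rewrite inE xX orbT.
  congr (_ + _); apply: wE; apply: (fmorph_inj Qpro2_incl).
  by rewrite !res_pro2E; apply: st; rewrite inE eqxx.
by move=> s t; rewrite -phiE /coboundary /= !phi1E res_pro2M chiM //; ring.
Qed.

Lemma normalized_liftP n (psi : GQpro2 -> carrier n) phi :
  (n < r)%N -> Epi theta psi -> trivialization theta psi phi ->
  cochain_lift psi (normalized_lift theta Sigma psi).
Proof.
move=> nr psiE phiT; have [phi' phi'P] := normalized_lift_exists nr psiE phiT.
rewrite /normalized_lift; set A := (X in xget _ X).
have [T _] : A (xget (fun _ => 0) A) by exact: xgetI phi'P.
exact: trivialization_lift.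
Qed.

Lemma Ptilde_ext (v v' : nat -> int) n : (forall j, (j < n)%N -> v j = v' j) ->
  Ptilde theta Sigma v n = Ptilde theta Sigma v' n.
Proof.
elim: n => [//|n IHn] vv' /=; rewrite IHn => [|j jn]; last exact/vv'/ltnW.
rewrite vv' // (_ : `[< in_span theta v n >] = `[< in_span theta v' n >]) //.
apply: asbool_equiv_eq; rewrite /in_span vv' //.
by split=> -[c cE]; exists c => s; rewrite cE; apply: eq_bigr => j _;
  rewrite vv' // ltnW // ltnS.
Qed.

Lemma comp2_continuous (T U V : choiceType) (h : T -> U -> V)
    (f : GQpro2 -> T) (g : GQpro2 -> U) :
  kcontinuous f -> kcontinuous g -> kcontinuous (fun s => h (f s) (g s)).
Proof.
move=> /kcontinuousP fc /kcontinuousP gc; apply/kcontinuousP => s.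
have [X XP] := fc s; have [Y YP] := gc s; exists (X ++ Y) => t st.
by rewrite XP ?YP // => x xX; apply: st; rewrite mem_cat xX ?orbT.
Qed.

Arguments comp2_continuous {T U V} h {f g}.

Lemma comp_continuous (T U : choiceType) (f : GQpro2 -> T) (h : T -> U) :
  kcontinuous f -> kcontinuous (fun s => h (f s)).
Proof.
move=> /kcontinuousP fc; apply/kcontinuousP => s; have [X XP] := fc s.
by exists X => t /XP ->.
Qed.

Arguments comp_continuous {T U f} h.

Lemma Ptilde_Epi v n psi : (n <= r)%N -> (forall j, v j != 0) ->
  Ptilde theta Sigma v n = Some psi ->
  Epi theta psi /\ forall j, (j < n)%N -> cochain0 theta j ->
    forall s, coord (psi s) j = chi (v j) s.
Proof.
move=> + v0; elim: n psi => [|n IHn] psi nr /=.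
  move=> [<-]; split=> //; split=> // [|g]; last by exists 1%g; case: g.
  by apply/kcontinuousP => s; exists [::].
case PE: (Ptilde _ _ v n) => [psi0|//]; have [psi0E psi0c] := IHn psi0 (ltnW nr) PE.
have [psi0k psi0M psi0S] := psi0E.
case: asboolP => [//|/contrapT[phi phiT]].
case: asboolP => [th0|nth0].
  case: asboolP => [//|nspan] [<-].
  have rhoM s t : (chi (v n) (s * t)%g, psi0 (s * t)%g) =
      @gmul theta n.+1 (chi (v n) s, psi0 s) (chi (v n) t, psi0 t).
    by rewrite /= chiM // psi0M th0 addr0.
  split; last first.
    move=> j; rewrite ltnS leq_eqVlt => /predU1P[-> _ s /=|jn j0 s /=].
      by rewrite eqxx.
    by rewrite ltn_eqF // psi0c.
  split=> //.
    exact: (comp2_continuous (V := carrier n.+1) pair (chi_continuous (v0 n)) psi0k).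
  have [//|[f [fE fth]]] := surj_or_factor adm nr rhoM psi0S.
  exfalso; apply: nspan.
  have [|c cE] := ghom_F2_span adm (f := f) (ltnW nr).
    by move=> g h; have := fth g h; rewrite th0 /coboundary => /esym/eqP;
       rewrite -addrA -opprD subr_eq0 => /eqP.
  exists c => s; rewrite -chi_res // [LHS]fE /= cE; apply: eq_bigr => j /asboolP j0.
  by rewrite psi0c // chi_res.
move=> [<-]; have [nlc nlM] := normalized_liftP nr psi0E phiT.
set nl := normalized_lift _ _ _ in nlc nlM *.
have rhoM s t : (nl (s * t)%g + chi (v n) (s * t)%g, psi0 (s * t)%g) =
      @gmul theta n.+1 (nl s + chi (v n) s, psi0 s) (nl t + chi (v n) t, psi0 t).
  by rewrite /= chiM // psi0M nlM; congr (_, _); ring.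
split; last first.
  move=> j; rewrite ltnS leq_eqVlt => /predU1P[-> //|jn j0 s /=].
  by rewrite ltn_eqF // psi0c.
split=> //.
  have sc := comp2_continuous (fun x y : 'F_2 => x + y) nlc (chi_continuous (v0 n)).
  exact: (comp2_continuous (V := carrier n.+1) pair sc psi0k).
have [//|[f [_ fth]]] := surj_or_factor adm nr rhoM psi0S.
by have [_ _ [H _]] := adm nr; case: nth0; apply: H; exists f.
Qed.

Lemma Ptilde_inj v v' n psi :
  (forall j, squarefree (v j)) -> (forall j, squarefree (v' j)) ->
  Ptilde theta Sigma v n = Some psi -> Ptilde theta Sigma v' n = Some psi ->
  forall j, (j < n)%N -> v j = v' j.
Proof.
move=> vs v's; elim: n psi => [//|n IHn] psi /=.
case PE: (Ptilde _ _ v n) => [psi0|//]; case PE': (Ptilde _ _ v' n) => [psi0'|//].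
case: asboolP => // _.
have key (f f' : GQpro2 -> 'F_2) :
    (fun s => (f s, psi0 s)) = psi -> (fun s => (f' s, psi0' s)) = psi ->
    psi0 = psi0' /\ forall s, f s = f' s.
  move=> E E'; have {}E s : (f s, psi0 s) = (f' s, psi0' s).
    by have := congr1 (fun h => h s) (etrans E (esym E')).
  by split=> [|s]; [apply/funext => s|]; case: (E s).
have fin : psi0 = psi0' -> (forall s : GQpro2, chi (v n) s = chi (v' n) s) ->
    forall j, (j < n.+1)%N -> v j = v' j.
  move=> E chiE j; rewrite ltnS leq_eqVlt => /predU1P[->|].
    by apply: (squarefree_chi_inj sys).
  by apply: (IHn psi0) => //; rewrite E.
have [th0|nth0] := pselect (cochain0 theta n).
  rewrite !(asboolT th0); case: asboolP => // _ [E].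
  case: asboolP => // _; case: asboolP => // _ [E'].
  by have [E0 chiE] := key _ _ E E'; exact: fin.
rewrite !(asboolF nth0) => -[E]; case: asboolP => // _ [E'].
have [E0 chiE] := key _ _ E E'; apply: fin => // s.
by have := chiE s; rewrite E0 => /addrI.
Qed.

Lemma Ptilde_surj n (psi : GQpro2 -> carrier n) : (n <= r)%N -> Epi theta psi ->
  exists2 v : nat -> int, forall j, squarefree (v j) & Ptilde theta Sigma v n = Some psi.
Proof.
elim: n psi => [|n IHn] psi nr [psik psiM psiS].
  exists (fun _ => 1) => [j|/=]; first exact: squarefree_unit.
  by congr Some; apply/funext => s; case: (psi s).
pose psi0 s := (psi s).2; pose a s := (psi s).1.
have psiE s : psi s = (a s, psi0 s) by rewrite /a /psi0; case: (psi s).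
have psi0E : Epi theta psi0.
  split; first exact: (comp_continuous snd psik).
    by move=> s t; rewrite /psi0 psiM.
  by move=> g; have [s sE] := psiS (0, g); exists s; rewrite /psi0 sE.
have ak : kcontinuous a by exact: (comp_continuous fst psik).
have aM s t : a (s * t)%g = a s + a t + theta (psi0 s) (psi0 t) by rewrite /a psiM.
have aT : trivialization theta psi0 (a \o res_pro2).
  split=> [|s t]; last by rewrite /coboundary /= res_pro2M aM; ring.
  apply/kcontinuousP => s; have [X XP] := (kcontinuousP a).1 ak (res_pro2 s).
  exists (map Qpro2_incl X) => t st; apply: XP => x xX.
  by apply: (fmorph_inj Qpro2_incl); rewrite !res_pro2E; apply: st; exact: map_f.
have [v0 v0s v0E] := IHn psi0 (ltnW nr) psi0E.
pose upd b j := if j == n then b else v0 j.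
have upds b : squarefree b -> forall j, squarefree (upd b j).
  by move=> sb j; rewrite /upd; case: eqP.
have updE b : Ptilde theta Sigma (upd b) n = Some psi0.
  by rewrite -v0E; apply: Ptilde_ext => j jn; rewrite /upd ltn_eqF.
have updn b : upd b n = b by rewrite /upd eqxx.
have [th0|nth0] := pselect (cochain0 theta n).
  have [|b sb bE] := squarefree_character ak; first by move=> s t; rewrite aM th0 addr0.
  exists (upd b); first exact: upds.
  rewrite /= updE asboolF; last by apply; exists (a \o res_pro2).
  rewrite asboolT // asboolF; last first.
    move=> [c cE]; have [s sE] := psiS (1, gid n); have [t tE] := res_pro2_surj s.
    have s0 : psi0 s = gid n by rewrite /psi0 sE.
    have upd0 j : upd b j != 0 by exact/squarefree_neq0/upds.
    have [_ psi0c] := Ptilde_Epi (ltnW nr) upd0 (updE b).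
    have := cE t; rewrite updn -chi_res ?(squarefree_neq0 sb) // tE -bE /a sE /=.
    rewrite big1 => [/eqP|j /asboolP j0]; first by rewrite oner_eq0.
    by rewrite -chi_res // tE -psi0c // s0 coord_gid mulr0.
  by congr Some; apply/funext => s; rewrite psiE updn bE.
have [nlc nlM] := normalized_liftP nr psi0E aT.
set nl := normalized_lift _ _ _ in nlc nlM.
have [||b sb bE] := @squarefree_character (fun s => a s - nl s).
- exact: (comp2_continuous (fun x y : 'F_2 => x - y) ak nlc).
- by move=> s t; rewrite aM nlM; ring.
exists (upd b); first exact: upds.
rewrite /= updE asboolF; last by apply; exists (a \o res_pro2).
rewrite asboolF // updn; congr Some; apply/funext => s.
by rewrite psiE -bE addrC subrK.
Qed.

Lemma Ptilde_None (v : nat -> int) n : (0 < r)%N -> v 0%N = 1 -> (0 < n)%N ->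
  Ptilde theta Sigma v n = None.
Proof.
move=> r0 v1; elim: n => // n IHn _ /=.
case: n IHn => [_|n ->] //=; case: ifP => // _.
have th0 : cochain0 theta 0 by have [_ th _] := adm r0; case; case.
rewrite (asboolT th0) asboolT //; exists (fun _ => 0) => s.
by rewrite big_ord0 v1 -chi_res // chi1.
Qed.

End Parametrization.

Theorem proposition3p1 (r : nat) (theta : cochains)
  (loc : forall p : nat, prime p -> local_closure p)
  (sigma : nat -> GQpro2) (sigma21 sigma22 : GQpro2)
  (r_ge1 : (1 <= r)%N)
  (theta_adm : admissible theta r)
  (sigma_sys : is_Sigma_system loc sigma sigma21 sigma22) :
  let P_G := @PG theta (Sigma_set sigma sigma21 sigma22) r in
  let solv := @Prim_solv theta (Sigma_set sigma sigma21 sigma22) r in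
  [/\ set_fun (@Prim (nontriv r)) ((Some @` @Epi theta r) `|` [set None]) P_G,
      set_surj (@Prim (nontriv r)) ((Some @` @Epi theta r) `|` [set None]) P_G
    & set_bij solv (Some @` @Epi theta r) P_G].
Proof.
move=> P_G solv.
have onto psi : Epi theta psi -> exists2 v, @Prim (nontriv r) v & P_G v = Some psi.
  move=> psiE; have [w ws wE] := Ptilde_surj theta_adm sigma_sys (leqnn r) psiE.
  have [v vP vw] := Pow_surj r ws; exists v => //.
  by rewrite /P_G /PG -wE; apply: Ptilde_ext.
split.
- move=> v vP; case PE: (P_G v) => [psi|]; last by right.
  left; exists psi => //.
  have [] := Ptilde_Epi theta_adm sigma_sys (leqnn r) _ PE => // j.
  exact/squarefree_neq0/squarefree_Pow.
- move=> _ [[psi psiE <-]|->]; first by have [v vP vE] := onto psi psiE; exists v.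
  have [v vP vE] := Pow_surj r (fun _ => squarefree_unit (a := 1) erefl); exists v => //.
  by apply: (Ptilde_None theta_adm) => //; exact: vE.
- split.
  + by move=> v [_ Pv].
  + move=> v v' /set_mem[vP [psi psiE PE]] /set_mem[v'P _] PE'.
    apply: Pow_inj => //; apply: (Ptilde_inj sigma_sys (v := Pow v) (v' := Pow v')).
    * by move=> j; exact: squarefree_Pow.
    * by move=> j; exact: squarefree_Pow.
    * exact/esym/PE.
    * by rewrite -[LHS]/(P_G v') -PE'; exact/esym/PE.
  + move=> _ [psi psiE <-]; have [v vP vE] := onto psi psiE.
    by exists v => //; split=> //; exists psi.
Qed.
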